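(* Let $p,q\in\mathbb{D}=\{z\in\mathbb{C}:|z|<1\}$. Among all conics with foci $p,q$ there is a unique one which is $4$-Poncelet inscribed in the unit circle $\mathbb{T}=\{z\in\mathbb{C}:|z|=1\}$. It is an ellipse, and it is the Blaschke ellipse.
   Context: The plane is identified with $\mathbb{C}$. A conic with foci $p,q$ means a non-degenerate ellipse or hyperbola with foci $p$ and $q$ (a circle centred at $p$ if $p=q$). A conic $\mathcal{C}$ is $4$-Poncelet inscribed in $\mathbb{T}$ if there is a closed polygonal line with $4$ sides inscribed in $\mathbb{T}$ (vertices on $\mathbb{T}$) and circumscribed about $\mathcal{C}$ (the lines containing the sides are tangent to $\mathcal{C}$; the points of tangency need not lie on the sides). As usual for Poncelet's theorem this is understood in the complexified projective plane: consecutive vertices are the two intersections of a side with $\mathbb{T}$, and consecutive sides are the two tangents from a vertex to $\mathcal{C}$, both counted with multiplicity; the trivial polygon sitting at a point of tangency of the two conics is not counted. For $w\in\mathbb{C}$ write $B_w(z)=\frac{w-z}{1-z\bar w}$. For $p,q\in\mathbb{D}$ there is a unique $c$ with $B_c(p)=q$, and $c\in\mathbb{D}$. Let $B(z)=z\,B_c(z)B_p(z)B_q(z)$, the degree-4 Blaschke product (up to a unimodular constant) with zeros $0,c,p,q$. The Blaschke curve associated with $B$ is the caustic (envelope) of the convex quadrilaterals whose vertices are the four solutions in $\mathbb{T}$ of $B(z)=\lambda$, $\lambda\in\mathbb{T}$; for this $B$ it is an ellipse, called the Blaschke ellipse (with foci $p,q$). *)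

(* Defs.v *)
From HB Require Import structures.
From mathcomp Require Import all_boot all_order all_algebra.
From mathcomp Require Import all_classical all_reals.
From mathcomp Require Import topology normedtype derive trigo.
From mathcomp Require Import complex ring.

Set Implicit Arguments.
Unset Strict Implicit.
Unset Printing Implicit Defensive.

Import Order.TTheory GRing.Theory Num.Theory.
Import numFieldNormedType.Exports.

Local Open Scope classical_set_scope.
Local Open Scope complex_scope.
Local Open Scope ring_scope.

(** Conics with given foci, as subsets of the plane [R[i]].  Norms in [R[i]]
    take their values in [R[i]]; the real parameter [s] is the major axis.
    When [p = q] the ellipses are the circles centred at [p], and there is no
    hyperbola. *)

Definition ellipse_with_foci (R : realType) (p q : R[i]) (S : set R[i]) : Prop :=
  exists2 s : R, `|p - q| < s%:C &
    S = [set z | `|z - p| + `|z - q| = s%:C].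

Definition hyperbola_with_foci (R : realType) (p q : R[i]) (S : set R[i]) : Prop :=
  exists2 s : R, 0 < s%:C < `|p - q| &
    S = [set z | `| `|z - p| - `|z - q| | = s%:C].

Definition conic_with_foci (R : realType) (p q : R[i]) (S : set R[i]) : Prop :=
  ellipse_with_foci p q S \/ hyperbola_with_foci p q S.

(** Points and lines of the projective plane over a field [F] are nonzero row
    vectors up to scaling, so that two of them agree iff [(u == v)%MS].  The
    line [L] consists of the points [P] with [P *m L^T = 0]; the conic of a
    symmetric matrix [A] consists of the points [P] with
    [P *m A *m P^T = 0]. *)

Definition incident (F : fieldType) (P L : 'rV[F]_3) : Prop := P *m L^T = 0.

Definition on_conic (F : fieldType) (A : 'M[F]_3) (P : 'rV[F]_3) : Prop :=
  P *m A *m P^T = 0.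

Definition tangent_at (F : fieldType) (A : 'M[F]_3) (P L : 'rV[F]_3) : Prop :=
  [/\ P != 0, on_conic A P & (L == P *m A)%MS].

Definition tangent_line (F : fieldType) (A : 'M[F]_3) (L : 'rV[F]_3) : Prop :=
  exists P : 'rV[F]_3, tangent_at A P L.

(** [P] and [Q] are the two intersections of [L] with the conic, counted with
    multiplicity. *)
Definition two_intersections (F : fieldType) (A : 'M[F]_3) (L P Q : 'rV[F]_3) :
    Prop :=
  [/\ incident P L /\ incident Q L, on_conic A P, on_conic A Q
    & (P == Q)%MS -> tangent_at A P L].

(** [L] and [M] are the two tangents from [P] to the conic, counted with
    multiplicity. *)
Definition two_tangents (F : fieldType) (A : 'M[F]_3) (P L M : 'rV[F]_3) :
    Prop :=
  [/\ incident P L /\ incident P M, tangent_line A L, tangent_line A M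
    & (L == M)%MS -> tangent_at A P L].

(** A closed [n]-gon with vertices [v i] and sides [l i], inscribed in the conic
    [A] and circumscribed about the conic [B]; the side [l i] joins [v i] to its
    cyclic successor. *)
Definition poncelet_polygon (F : fieldType) (A B : 'M[F]_3) (n : nat)
    (v l : 'I_n -> 'rV[F]_3) : Prop :=
  forall i : 'I_n,
    [/\ v i != 0, l i != 0, two_intersections A (l i) (v i) (v (ordS i))
      & two_tangents B (v (ordS i)) (l i) (l (ordS i))].

(** The constant polygon sitting at a point of tangency of the two conics. *)
Definition trivial_polygon (F : fieldType) (A B : 'M[F]_3) (n : nat)
    (v l : 'I_n -> 'rV[F]_3) : Prop :=
  exists P L : 'rV[F]_3, [/\ tangent_at A P L, tangent_at B P L
    & forall i : 'I_n, (v i == P)%MS /\ (l i == L)%MS].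

Definition affine_point (R : realType) (z : R[i]) : 'rV[R]_3 :=
  \row_(j < 3) [:: complex.Re z; complex.Im z; 1]`_j.

Definition conic_equation (R : realType) (A : 'M[R]_3) (S : set R[i]) : Prop :=
  [/\ A^T = A, \det A != 0 & S = [set z | on_conic A (affine_point z)]].

(** The unit circle [x ^+ 2 + y ^+ 2 - w ^+ 2 = 0]. *)
Definition circle_mx (R : realType) : 'M[R]_3 :=
  diag_mx (\row_(j < 3) [:: 1; 1; -1]`_j).

(** [S] is [n]-Poncelet inscribed in the unit circle.  The polygon lives in the
    complexified projective plane. *)
Definition poncelet_inscribed (R : realType) (n : nat) (S : set R[i]) : Prop :=
  exists A : 'M[R]_3, conic_equation A S /\
    let T := map_mx (real_complex R) (circle_mx R) in
    let C := map_mx (real_complex R) A in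
    exists v l : 'I_n -> 'rV[R[i]]_3,
      poncelet_polygon T C v l /\ ~ trivial_polygon T C v l.

Definition blaschke_factor (R : realType) (w z : R[i]) : R[i] :=
  (w - z) / (1 - z * w^*).

(** The point [c] of the unit disc with [blaschke_factor c p = q], see
    [blaschke_centerP]. *)
Definition blaschke_center (R : realType) (p q : R[i]) : R[i] :=
  xget 0 [set c : R[i] | `|c| < 1 /\ blaschke_factor c p = q].

Definition blaschke4 (R : realType) (p q : R[i]) (z : R[i]) : R[i] :=
  z * blaschke_factor (blaschke_center p q) z
    * blaschke_factor p z * blaschke_factor q z.

Definition circle_point (R : realType) (t : R) : R[i] := cos t +i* sin t.

(** The argument of the first solution of [B z = B (circle_point t)] met when
    travelling counterclockwise along the unit circle from [circle_point t]. *)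
Definition next_solution (R : realType) (B : R[i] -> R[i]) (t : R) : R :=
  inf [set s : R | t < s /\ B (circle_point s) = B (circle_point t)].

(** Vanishes iff [x] lies on the line joining [circle_point t] to the next
    solution.  For [circle_point t] running through the solutions of [B z = a],
    these lines carry the sides of the convex polygon they span. *)
Definition side_form (R : realType) (B : R[i] -> R[i]) (x : R[i]) (t : R) : R :=
  let u := circle_point t in
  let v := circle_point (next_solution B t) in
  complex.Im ((x - u) * (v - u)^*).

(** The envelope of the one-parameter family of lines [side_form B x t = 0]:
    the points [x] at which both the form and its derivative in [t] vanish for
    some [t]. *)
Definition blaschke_curve (R : realType) (B : R[i] -> R[i]) : set R[i] :=
  [set x | exists t : R,
    side_form B x t = 0 /\ is_derive t (1 : R) (side_form B x) (0 : R)].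

Section BlaschkeCenter.
Variable R : realType.
Implicit Types p q c : R[i].

Lemma blaschke_den_neq0 p c : `|p| < 1 -> `|c| < 1 -> 1 - p * c^* != 0.
Proof.
move=> hp hc; apply/negP => /eqP/subr0_eq h.
have : `|p * c^*| < 1.
  by rewrite normrM norm_conjC; apply: mulr_ilt1.
by rewrite -h normr1 ltxx.
Qed.

Lemma blaschke_center_exists p q : `|p| < 1 -> `|q| < 1 ->
  exists! c, `|c| < 1 /\ blaschke_factor c p = q.
Proof.
move=> hp hq.
have ab1 : `|p| * `|q| < 1 by apply: mulr_ilt1.
pose N : R[i] := 1 - (`|p| * `|q|) ^+ 2.
have N0 : 0 < N by rewrite subr_gt0 expr_lt1 // mulr_ge0.
have Nn0 : N != 0 by rewrite gt_eqF.
have NE : N = 1 - (p * p^*) * (q * q^*) by rewrite /N exprMn !normCK.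
have Nc : N^* = N by rewrite NE !(rmorphB, rmorphM, rmorph1) /= !conjCK; ring.
pose c0 : R[i] := (p * (1 - q * q^*) + q * (1 - p * p^*)) / N.
have c0N : c0 * N = p * (1 - q * q^*) + q * (1 - p * p^*).
  by rewrite /c0 divfK.
have c0cN : c0^* * N = p^* * (1 - q * q^*) + q^* * (1 - p * p^*).
  rewrite -{1}Nc -rmorphM c0N !(rmorphD, rmorphN, rmorphM, rmorph1) /= !conjCK.
  by ring.
have hc0 : `|c0| < 1.
  rewrite -(ltr_pM2r N0) mul1r -{1}(gtr0_norm N0) -normrM c0N.
  apply: (le_lt_trans (ler_normD _ _)); rewrite !normrM -!normCK.
  rewrite (@ger0_norm _ (1 - `|q| ^+ 2)); last first.
    by rewrite subr_ge0 expr_le1 // ltW.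
  rewrite (@ger0_norm _ (1 - `|p| ^+ 2)); last first.
    by rewrite subr_ge0 expr_le1 // ltW.
  rewrite -subr_gt0 /N; set a := `|p|; set b := `|q|.
  have -> : 1 - (a * b) ^+ 2 - (a * (1 - b ^+ 2) + b * (1 - a ^+ 2)) =
    (1 - a * b) * ((1 - a) * (1 - b)) by ring.
  by rewrite !mulr_gt0 ?subr_gt0.
have eqc c : `|c| < 1 ->
    (blaschke_factor c p = q) <-> c - p = q * (1 - p * c^*).
  move=> hc; rewrite /blaschke_factor; have d0 := blaschke_den_neq0 hp hc.
  by split=> [<-|->]; rewrite ?divfK ?mulfK.
have h0 : c0 - p = q * (1 - p * c0^*).
  apply: (mulIf Nn0).
  have -> : (c0 - p) * N = c0 * N - p * N by ring.
  have -> : q * (1 - p * c0^*) * N = q * N - q * p * (c0^* * N) by ring.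
  by rewrite c0N c0cN NE; ring.
exists c0; split; first by split=> //; apply/(eqc _ hc0).
move=> c [hc /(eqc _ hc) h].
have e : c0 - c = - (p * q) * (c0 - c)^*.
  rewrite rmorphB /=.
  have -> : c0 - c = (c0 - p) - (c - p) by ring.
  by rewrite h0 h; ring.
have e1 : `|c0 - c| * (1 - `|p| * `|q|) = 0.
  rewrite mulrBr mulr1 {1}e normrM normrN normrM norm_conjC.
  by rewrite mulrC subrr.
move/eqP: e1; rewrite mulf_eq0 (gt_eqF (_ : 0 < 1 - _)) ?subr_gt0 // orbF.
by rewrite normr_eq0 => /eqP/subr0_eq.
Qed.

Lemma blaschke_centerP p q : `|p| < 1 -> `|q| < 1 ->
  `|blaschke_center p q| < 1 /\ blaschke_factor (blaschke_center p q) p = q.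
Proof.
move=> hp hq; have [c [hc _]] := blaschke_center_exists hp hq.
exact: (@xgetPex _ 0 [set c : R[i] | `|c| < 1 /\ blaschke_factor c p = q]
  (ex_intro _ c hc)).
Qed.

End BlaschkeCenter.

(* Main.v *)
(** Write lines in the coordinates dual to the plane. The conics with foci [p]
    and [q] are the pencil of dual conics [<l, p> <l, q> = k (a^2 + b^2)], one for
    each value of [k] (the signed square of the semi-minor axis). On the chord
    through two points of the circle with rational parameters [x], [y] this
    relation becomes a symmetric bilinear form [M] in the Veronese images of [x]
    and [y]. In a closed quadrilateral, opposite vertices are sent by [M] to the
    same line, so they agree if [M] is invertible, and the quadrilateral is then
    trivial. Hence [det M = 0], an affine equation in [k] with a unique solution,
    which is positive.

    Conversely, for this [k] the difference [B x - B y] factors as a multiple of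
    [x - y], of the condition that the chord passes through [c], and of the
    tangency condition. Lifting [z B_c z] and [B_p B_q] to increasing functions of
    the argument shows that consecutive solutions of [B z = a] can only satisfy
    the last condition, so that the sides are tangent to the conic; differentiating
    the tangency condition along the sides identifies their envelope. *)
Require Import Defs.
From mathcomp Require Import all_boot all_order all_algebra.
From mathcomp Require Import all_classical all_reals.
From mathcomp Require Import topology normedtype derive realfun trigo.
From mathcomp Require Import complex ring lra.

Set Implicit Arguments.
Unset Strict Implicit.
Unset Printing Implicit Defensive.

Import Order.TTheory GRing.Theory Num.Theory.
Import numFieldNormedType.Exports.

Local Open Scope classical_set_scope.
Local Open Scope complex_scope.
Local Open Scope ring_scope.

(** * Rows and symmetric matrices *)

Section Rows.
Variable F : fieldType.
Implicit Types a b c d e f : F.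

Definition row3 a b c : 'rV[F]_3 := \row_(j < 3) [:: a; b; c]`_j.

Definition sym3 a b c d e f : 'M[F]_3 :=
  \matrix_(i < 3, j < 3) (nth [::] [:: [:: a; b; c]; [:: b; d; e]; [:: c; e; f]] i)`_j.

Definition det3 a b c d e f : F :=
  a * (d * f - e ^+ 2) - b * (b * f - c * e) + c * (b * e - c * d).

Definition adj3 a b c d e f : 'M[F]_3 :=
  sym3 (d * f - e ^+ 2) (c * e - b * f) (b * e - c * d)
       (a * f - c ^+ 2) (b * c - a * e) (a * d - b ^+ 2).

Lemma row3_eta (v : 'rV[F]_3) : exists a b c, v = row3 a b c.
Proof.
exists (v ord0 (inord 0)), (v ord0 (inord 1)), (v ord0 (inord 2)).
apply/rowP => j; rewrite mxE; case: j => [[|[|[|//]]] hj] /=;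
  congr (v _ _); apply/val_inj; by rewrite /= inordK.
Qed.

Lemma row3_inj a b c a' b' c' : row3 a b c = row3 a' b' c' ->
  [/\ a = a', b = b' & c = c'].
Proof.
move=> /rowP h; have := (h (inord 0), h (inord 1), h (inord 2)).
by rewrite !mxE !inordK //= => -[[-> ->] ->].
Qed.

Lemma row3_eq0 a b c : (row3 a b c == 0) = [&& a == 0, b == 0 & c == 0].
Proof.
have r0 : 0 = row3 0 0 0.
  by apply/rowP => j; rewrite !mxE; case: j => [[|[|[|//]]] hj].
apply/eqP/and3P => [|[/eqP -> /eqP -> /eqP ->]]; last by rewrite r0.
by rewrite r0 => /row3_inj [-> -> ->].
Qed.

Lemma scale_row3 k a b c : k *: row3 a b c = row3 (k * a) (k * b) (k * c).
Proof. by apply/rowP => j; rewrite !mxE; case: j => [[|[|[|//]]] hj]. Qed.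

Lemma dot_row3 a b c a' b' c' :
  row3 a b c *m (row3 a' b' c')^T = (a * a' + b * b' + c * c')%:M.
Proof.
apply/matrixP => i j; rewrite !ord1 !mxE !big_ord_recl big_ord0 !mxE /=.
by rewrite addr0 addrA.
Qed.

Lemma dot_row3_eq0 a b c a' b' c' :
  row3 a b c *m (row3 a' b' c')^T = 0 <-> a * a' + b * b' + c * c' = 0.
Proof.
rewrite dot_row3; split=> [/matrixP/(_ 0 0)|->]; first by rewrite !mxE mulr1n.
by rewrite raddf0.
Qed.

Lemma row3_sym3 x y z a b c d e f : row3 x y z *m sym3 a b c d e f =
  row3 (x * a + y * b + z * c) (x * b + y * d + z * e) (x * c + y * e + z * f).
Proof.
apply/rowP => j; rewrite !mxE !big_ord_recl big_ord0 !mxE /=.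
by case: j => [[|[|[|//]]] hj] /=; rewrite addr0 addrA.
Qed.

Lemma tr_sym3 a b c d e f : (sym3 a b c d e f)^T = sym3 a b c d e f.
Proof.
apply/matrixP => i j; rewrite !mxE.
by case: i j => [[|[|[|//]]] hi] [[|[|[|//]]] hj].
Qed.

Lemma scale_sym3 k a b c d e f : k *: sym3 a b c d e f =
  sym3 (k * a) (k * b) (k * c) (k * d) (k * e) (k * f).
Proof.
apply/matrixP => i j; rewrite !mxE.
by case: i j => [[|[|[|//]]] hi] [[|[|[|//]]] hj].
Qed.

Lemma sym3_eta (A : 'M[F]_3) : A^T = A -> exists a b c d e f,
  A = sym3 a b c d e f.
Proof.
move=> hA; have s i j : A i j = A j i by rewrite -{1}hA mxE.
pose o k : 'I_3 := inord k.
exists (A (o 0) (o 0)), (A (o 0) (o 1)), (A (o 0) (o 2)), (A (o 1) (o 1)),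
  (A (o 1) (o 2)), (A (o 2) (o 2)).
apply/matrixP => i j; rewrite mxE.
have oE (i' : 'I_3) : i' = o i' by rewrite /o inord_val.
rewrite {1}(oE i) {1}(oE j).
case: i j => [[|[|[|//]]] hi] [[|[|[|//]]] hj] //=; exact: s.
Qed.

Lemma mul_sym3_adj3 a b c d e f :
  sym3 a b c d e f *m adj3 a b c d e f = (det3 a b c d e f)%:M.
Proof.
apply/matrixP => i j; rewrite !mxE !big_ord_recl big_ord0 !mxE /=.
by case: i j => [[|[|[|//]]] hi] [[|[|[|//]]] hj] /=;
  rewrite ?mulr1n ?mulr0n /det3; ring.
Qed.

Lemma mul_adj3_sym3 a b c d e f :
  adj3 a b c d e f *m sym3 a b c d e f = (det3 a b c d e f)%:M.
Proof.
apply: trmx_inj; rewrite trmx_mul !tr_sym3 mul_sym3_adj3.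
by rewrite tr_scalar_mx.
Qed.

Lemma unitmx_sym3 a b c d e f :
  det3 a b c d e f != 0 -> sym3 a b c d e f \in unitmx.
Proof.
move=> h; have /mulmx1_unit[] // : sym3 a b c d e f *m
    ((det3 a b c d e f)^-1 *: adj3 a b c d e f) = 1%:M.
by rewrite -scalemxAr mul_sym3_adj3 scale_scalar_mx mulVf.
Qed.

Definition quad (A : 'M[F]_3) (v : 'rV[F]_3) : F := (v *m A *m v^T) 0 0.

Lemma on_conicE (A : 'M[F]_3) v : on_conic A v <-> quad A v = 0.
Proof.
rewrite /quad; split=> [->|h]; first by rewrite mxE.
by apply/matrixP => i j; rewrite !ord1 h mxE.
Qed.

Lemma quad_sym3 a b c d e f x y z :
  quad (sym3 a b c d e f) (row3 x y z) =
  a * x ^+ 2 + d * y ^+ 2 + f * z ^+ 2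
    + 2 * (b * x * y + c * x * z + e * y * z).
Proof. by rewrite /quad row3_sym3 dot_row3 mxE mulr1n; ring. Qed.

Lemma quadZ k A v : quad (k *: A) v = k * quad A v.
Proof. by rewrite /quad -scalemxAr -scalemxAl mxE. Qed.

Lemma eq_row_scale k (u : 'rV[F]_3) : k != 0 -> (u == k *: u)%MS.
Proof.
move=> k0; apply/andP; split; apply/sub_rVP; last by exists k.
by exists k^-1; rewrite scalerA mulVf // scale1r.
Qed.

Lemma eq_row_sym (u v : 'rV[F]_3) : (u == v)%MS = (v == u)%MS.
Proof. by rewrite andbC. Qed.

Lemma eq_row_trans (v u w : 'rV[F]_3) :
  (u == v)%MS -> (v == w)%MS -> (u == w)%MS.
Proof.
move=> /andP[uv vu] /andP[vw wv].
by rewrite (submx_trans uv vw) (submx_trans wv vu).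
Qed.

Lemma eq_row_mulr (A : 'M[F]_3) (u v : 'rV[F]_3) :
  (u == v)%MS -> (u *m A == v *m A)%MS.
Proof. by move=> /andP[uv vu]; rewrite !submxMr. Qed.

End Rows.

(** * Confocal conics *)

Section Confocal.
Variable F : fieldType.
Hypothesis two_neq0 : (2 : F) != 0.
Variables p1 p2 q1 q2 k : F.

(** The form $\langle l,p\rangle\langle l,q\rangle-k(a^2+b^2)$ on lines $l=(a,b,c)$, symmetrised. It
    vanishes on the lines whose signed distances to the two foci have product $k$. *)
Definition confocal_dual : 'M[F]_3 :=
  sym3 (p1 * q1 - k) ((p1 * q2 + p2 * q1) / 2) ((p1 + q1) / 2)
       (p2 * q2 - k) ((p2 + q2) / 2) 1.

(** The point conic is taken as the adjugate of the dual one, which keeps it polynomial in [k]; the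
    two are inverse up to the scalar [confocal_det]. *)
Definition confocal_mx : 'M[F]_3 :=
  adj3 (p1 * q1 - k) ((p1 * q2 + p2 * q1) / 2) ((p1 + q1) / 2)
       (p2 * q2 - k) ((p2 + q2) / 2) 1.

Definition confocal_det : F :=
  k * (k + ((p1 - q1) ^+ 2 + (p2 - q2) ^+ 2) / 4).

Lemma confocal_detE :
  det3 (p1 * q1 - k) ((p1 * q2 + p2 * q1) / 2) ((p1 + q1) / 2)
       (p2 * q2 - k) ((p2 + q2) / 2) 1 = confocal_det.
Proof.
have four_neq0 : (4 : F) != 0 by rewrite (natrM F 2 2) mulf_neq0.
by rewrite /det3 /confocal_det; field; rewrite two_neq0 four_neq0.
Qed.

Lemma mul_confocal_dual_mx : confocal_dual *m confocal_mx = confocal_det%:M.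
Proof. by rewrite mul_sym3_adj3 confocal_detE. Qed.

Lemma mul_confocal_mx_dual : confocal_mx *m confocal_dual = confocal_det%:M.
Proof. by rewrite mul_adj3_sym3 confocal_detE. Qed.

Lemma tr_confocal_dual : confocal_dual^T = confocal_dual.
Proof. exact: tr_sym3. Qed.

Lemma tr_confocal_mx : confocal_mx^T = confocal_mx.
Proof. exact: tr_sym3. Qed.

Lemma det_confocal_mx : confocal_det != 0 -> \det confocal_mx != 0.
Proof.
move=> d0; have : \det (confocal_mx *m confocal_dual) != 0.
  by rewrite mul_confocal_mx_dual det_scalar expf_neq0.
by rewrite det_mulmx mulf_eq0 => /norP[].
Qed.

Lemma confocal_dualE a b c a' b' c' :
  row3 a b c *m confocal_dual *m (row3 a' b' c')^T =
  (((a * p1 + b * p2 + c) * (a' * q1 + b' * q2 + c')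
   + (a' * p1 + b' * p2 + c') * (a * q1 + b * q2 + c)) / 2
   - k * (a * a' + b * b'))%:M.
Proof. by rewrite row3_sym3 dot_row3; congr (_%:M); field. Qed.

(** With $s^2$ = [s2] and $r_1^2$, $r_2^2$ = [d1], [d2], the right-hand side is
    $(s^2-(r_1+r_2)^2)(s^2-(r_1-r_2)^2)$, so one quadratic equation serves both ellipses and
    hyperbolas. *)
Lemma quad_confocal_mx x y : 16 * quad confocal_mx (row3 x y 1) =
  let s2 := 4 * k + (p1 - q1) ^+ 2 + (p2 - q2) ^+ 2 in
  let d1 := (x - p1) ^+ 2 + (y - p2) ^+ 2 in
  let d2 := (x - q1) ^+ 2 + (y - q2) ^+ 2 in
  s2 ^+ 2 - 2 * s2 * (d1 + d2) + (d1 - d2) ^+ 2.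
Proof. by rewrite quad_sym3 /=; field. Qed.

End Confocal.

(** * Focal conics as zero sets of matrices, and uniqueness of the matrix *)

Section FocalSets.
Variable R : realType.
Implicit Types (p q z : R[i]) (s k : R).

Local Notation Re := complex.Re.
Local Notation Im := complex.Im.

(** The modulus with values in the ordered field [R]. *)
Definition nrm z : R := Num.sqrt (Re z ^+ 2 + Im z ^+ 2).

Lemma normE z : `|z| = (nrm z)%:C.
Proof. by case: z. Qed.

Lemma nrm_real (x : R) : nrm x%:C = `|x|.
Proof. by rewrite /nrm /= expr0n addr0 sqrtr_sqr. Qed.

Lemma nrm_ge0 z : 0 <= nrm z. Proof. exact: sqrtr_ge0. Qed.

Lemma nrm_sqr z : nrm z ^+ 2 = Re z ^+ 2 + Im z ^+ 2.
Proof. by rewrite sqr_sqrtr // addr_ge0 ?sqr_ge0. Qed.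

Lemma Re_sub z w : Re (z - w) = Re z - Re w. Proof. by case: z w => ? ? []. Qed.
Lemma Im_sub z w : Im (z - w) = Im z - Im w. Proof. by case: z w => ? ? []. Qed.

Lemma nrm_triangle p q z : nrm (p - q) <= nrm (z - p) + nrm (z - q).
Proof.
rewrite -lecR rmorphD /= -!normE [`|z - p|]distrC.
exact: ler_distD.
Qed.

Lemma nrm_triangleN p q z : `|nrm (z - p) - nrm (z - q)| <= nrm (p - q).
Proof.
have C1 : nrm (z - p) <= nrm (z - q) + nrm (p - q).
  by rewrite -lecR rmorphD /= -!normE [`|p - q|]distrC; exact: ler_distD.
have C2 : nrm (z - q) <= nrm (z - p) + nrm (p - q).
  by rewrite -lecR rmorphD /= -!normE; exact: ler_distD.
by rewrite ler_norml; lra.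
Qed.

Definition focal_mx p q k := confocal_mx (Re p) (Im p) (Re q) (Im q) k.
Definition focal_dual p q k := confocal_dual (Re p) (Im p) (Re q) (Im q) k.

Lemma focal_mxE p q k s z : 4 * k = s ^+ 2 - nrm (p - q) ^+ 2 ->
  on_conic (focal_mx p q k) (affine_point z) <->
  (s - nrm (z - p) - nrm (z - q)) * (s + nrm (z - p) + nrm (z - q)) *
  ((s - (nrm (z - p) - nrm (z - q))) * (s + (nrm (z - p) - nrm (z - q)))) = 0.
Proof.
move=> hk; rewrite on_conicE.
have := quad_confocal_mx _ (Re p) (Im p) (Re q) (Im q) k (Re z) (Im z).
rewrite pnatr_eq0 /= -/(focal_mx p q k) -/(affine_point z) => /(_ isT).
rewrite hk nrm_sqr Re_sub Im_sub.
have -> : (Re z - Re p) ^+ 2 + (Im z - Im p) ^+ 2 = nrm (z - p) ^+ 2.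
  by rewrite nrm_sqr Re_sub Im_sub.
have -> : (Re z - Re q) ^+ 2 + (Im z - Im q) ^+ 2 = nrm (z - q) ^+ 2.
  by rewrite nrm_sqr Re_sub Im_sub.
set Q := quad _ _ => QE; split=> h; last first.
  apply: (@mulfI _ 16); first by rewrite pnatr_eq0.
  by rewrite QE mulr0 -[RHS]h; ring.
by move: QE; rewrite h mulr0 => ->; ring.
Qed.

Lemma ellipse_setE p q k s : 4 * k = s ^+ 2 - nrm (p - q) ^+ 2 ->
  nrm (p - q) < s ->
  [set z | `|z - p| + `|z - q| = s%:C] =
  [set z | on_conic (focal_mx p q k) (affine_point z)].
Proof.
move=> hk hs; apply/seteqP; split=> z /=; rewrite (focal_mxE _ hk) !normE.
  rewrite -rmorphD => -[<-].
  by rewrite [X in X * _](_ : _ = 0) ?mul0r //; ring.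
(* Since $\bigl||z-p|-|z-q|\bigr|\le|p-q|<s$, only the factor $s-|z-p|-|z-q|$ can vanish. *)
have := nrm_triangleN p q z; rewrite ler_norml => /andP[h1 h2].
move=> /eqP; rewrite mulf_eq0 => /orP[]; rewrite mulf_eq0 => /orP[] /eqP h;
  have := nrm_ge0 (z - p); have := nrm_ge0 (z - q); have := nrm_ge0 (p - q) => *;
  try (exfalso; lra).
by rewrite -rmorphD; congr (_%:C); lra.
Qed.

Lemma hyperbola_setE p q k s : 4 * k = s ^+ 2 - nrm (p - q) ^+ 2 ->
  0 < s < nrm (p - q) ->
  [set z | `| `|z - p| - `|z - q| | = s%:C] =
  [set z | on_conic (focal_mx p q k) (affine_point z)].
Proof.
move=> hk /andP[s0 hs]; apply/seteqP; split=> z /=;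
  rewrite (focal_mxE _ hk) !normE -rmorphB nrm_real.
  move=> -[<-]; case: (lerP 0 (nrm (z - p) - nrm (z - q))) => h.
    by rewrite ger0_norm //; ring.
  by rewrite ltr0_norm //; ring.
(* Here $|z-p|+|z-q|\ge|p-q|>s$ excludes the first two factors. *)
have := nrm_triangle p q z.
move=> h1 /eqP; rewrite mulf_eq0 => /orP[]; rewrite mulf_eq0 => /orP[] /eqP h;
  have := nrm_ge0 (z - p); have := nrm_ge0 (z - q) => *;
  try (exfalso; lra); congr (_%:C).
  by rewrite ger0_norm; lra.
by rewrite ler0_norm; lra.
Qed.

(** [A] is the semi-major axis and [k] the signed square of the other one. A few real points fix the
    coefficients: $(\pm A,0)$, and then, with $b=\sqrt{|k|}$, the points $(0,\pm b)$ and
    $(3A/5,4b/5)$ of an ellipse, or three of the points $(\pm5A/4,\pm3b/4)$ of a hyperbola. *)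
Lemma quadratic_through_central_conic (A k al be ga de ep ze : R) :
  0 < A -> k != 0 ->
  (forall X Y, k * X ^+ 2 + A ^+ 2 * Y ^+ 2 = A ^+ 2 * k ->
    al * X ^+ 2 + be * (X * Y) + ga * Y ^+ 2 + de * X + ep * Y + ze = 0) ->
  exists la, forall X Y,
    al * X ^+ 2 + be * (X * Y) + ga * Y ^+ 2 + de * X + ep * Y + ze =
    la * (k * X ^+ 2 + A ^+ 2 * Y ^+ 2 - A ^+ 2 * k).
Proof.
move=> A0 k0 H; have nA : A != 0 by rewrite gt_eqF.
have [e1 e2] : de = 0 /\ ze = - (al * A ^+ 2).
  have := H A 0; have := H (- A) 0.
  move=> /(_ ltac:(ring)) h1 /(_ ltac:(ring)) h2; split; last by lra.
  by apply: (mulIf nA); lra.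
have [e3 [e4 e5]] : [/\ be = 0, ep = 0 & ga * k = al * A ^+ 2].
  case: (ltrP 0 k) => kp.
    pose b := Num.sqrt k; have kE : k = b ^+ 2 by rewrite sqr_sqrtr // ltW.
    have nb : b != 0 by apply: contraNneq k0; rewrite kE => ->; rewrite expr0n.
    rewrite kE in H *.
    have := H 0 b; have := H 0 (- b); have := H (3 / 5 * A) (4 / 5 * b).
    move=> /(_ ltac:(field)) h1 /(_ ltac:(ring)) h2 /(_ ltac:(ring)) h3.
    have ep0 : ep = 0 by apply: (mulIf nb); lra.
    split=> //; last by rewrite e1 e2 in h1 h2 h3; lra.
    apply: (mulIf (mulf_neq0 nA nb)); rewrite e1 e2 ep0 in h1 h2 h3; lra.
  pose b := Num.sqrt (- k).
  have kE : k = - b ^+ 2 by rewrite sqr_sqrtr ?opprK // oppr_ge0.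
  have nb : b != 0.
    by apply: contraNneq k0; rewrite kE => ->; rewrite expr0n oppr0.
  rewrite kE in H *.
  have := H (5 / 4 * A) (3 / 4 * b); have := H (5 / 4 * A) (- (3 / 4 * b)).
  have := H (- (5 / 4 * A)) (3 / 4 * b).
  move=> /(_ ltac:(field)) h1 /(_ ltac:(field)) h2 /(_ ltac:(field)) h3.
  rewrite e1 e2 in h1 h2 h3.
  split; last by lra.
    by apply: (mulIf (mulf_neq0 nA nb)); lra.
  by apply: (mulIf nb); lra.
have nA2 : A ^+ 2 != 0 by rewrite expf_neq0.
exists (al / k) => X Y.
have -> : ga = al * A ^+ 2 / k by rewrite -e5 mulfK.
by rewrite e1 e2 e3 e4; field.
Qed.

Lemma sym3_eq_quad (a b c d e f a' b' c' d' e' f' : R) :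
  (forall x y, quad (sym3 a b c d e f) (row3 x y 1) =
    quad (sym3 a' b' c' d' e' f') (row3 x y 1)) ->
  sym3 a b c d e f = sym3 a' b' c' d' e' f'.
Proof.
move=> H; have h0 := H 0 0; have h1 := H 1 0; have h2 := H (-1) 0.
have h3 := H 0 1; have h4 := H 0 (-1); have h5 := H 1 1.
rewrite !quad_sym3 in h0 h1 h2 h3 h4 h5.
by congr sym3; lra.
Qed.

(* The coefficients are determined up to a scalar by five points of the conic. *)
Lemma focal_mx_uniq p q k (A : 'M[R]_3) : k != 0 ->
  0 < 4 * k + nrm (p - q) ^+ 2 -> A^T = A -> \det A != 0 ->
  (forall z, on_conic (focal_mx p q k) (affine_point z) ->
    on_conic A (affine_point z)) ->
  exists2 l, l != 0 & A = l *: focal_mx p q k.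
Proof.
move=> k0 hs /sym3_eta [a [b [c [d [e [f AE]]]]]] dA H.
suff [l hl] : exists l, A = l *: focal_mx p q k.
  exists l => //; apply: contraNneq dA => l0.
  by rewrite hl l0 scale0r det0.
rewrite nrm_sqr Re_sub Im_sub in hs.
case: p q hs H => p1 p2 [q1 q2] /= hs H.
set n := Num.sqrt ((q1 - p1) ^+ 2 + (q2 - p2) ^+ 2).
have n2 : n ^+ 2 = (q1 - p1) ^+ 2 + (q2 - p2) ^+ 2.
  by rewrite sqr_sqrtr // addr_ge0 ?sqr_ge0.
(* A unit vector along the focal axis; when the foci coincide every direction serves, and $(1,0)$ is
   taken. *)
have [e1 [e2 [he h1 h2]]] : exists e1 e2 : R,
    [/\ e1 ^+ 2 + e2 ^+ 2 = 1, q1 - p1 = n * e1 & q2 - p2 = n * e2].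
  case: (eqVneq n 0) => n0.
    exists 1, 0; rewrite n0 in n2 *.
    move: n2; rewrite expr0n /= => /esym/eqP.
    rewrite paddr_eq0 ?sqr_ge0 // !sqrf_eq0 => /andP[/eqP -> /eqP ->].
    by split; ring.
  exists ((q1 - p1) / n), ((q2 - p2) / n); split; [|by field..].
  by rewrite !expr_div_n -mulrDl -n2 divff // expf_neq0.
(* Passage to coordinates [X], [Y] along and across the axis: [m1], [m2] is the centre, [r] the
   semi-major axis and [t] half the focal distance, so that $k=r^2-t^2$. *)
pose m1 := (p1 + q1) / 2; pose m2 := (p2 + q2) / 2.
pose s2 := k + n ^+ 2 / 4.
have s2p : 0 < s2 by rewrite /s2 n2; lra.
pose r := Num.sqrt s2; have r0 : 0 < r by rewrite sqrtr_gt0.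
have rE : r ^+ 2 = k + n ^+ 2 / 4 by rewrite sqr_sqrtr // ltW.
pose t := n / 2.
have p1E : p1 = m1 - t * e1 by rewrite /m1 /t; lra.
have q1E : q1 = m1 + t * e1 by rewrite /m1 /t; lra.
have p2E : p2 = m2 - t * e2 by rewrite /m2 /t; lra.
have q2E : q2 = m2 + t * e2 by rewrite /m2 /t; lra.
have kE : k = r ^+ 2 - t ^+ 2 by rewrite rE /t; field.
have quadE a' b' c' d' e' f' X Y :
    quad (sym3 a' b' c' d' e' f')
      (row3 (m1 + X * e1 - Y * e2) (m2 + X * e2 + Y * e1) 1) =
    (a' * e1 ^+ 2 + d' * e2 ^+ 2 + 2 * b' * e1 * e2) * X ^+ 2
    + 2 * ((d' - a') * e1 * e2 + b' * (e1 ^+ 2 - e2 ^+ 2)) * (X * Y)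
    + (a' * e2 ^+ 2 + d' * e1 ^+ 2 - 2 * b' * e1 * e2) * Y ^+ 2
    + 2 * (a' * m1 * e1 + d' * m2 * e2 + b' * (m1 * e2 + m2 * e1) + c' * e1
           + e' * e2) * X
    + 2 * (d' * m2 * e1 - a' * m1 * e2 + b' * (m1 * e1 - m2 * e2) - c' * e2
           + e' * e1) * Y
    + (a' * m1 ^+ 2 + d' * m2 ^+ 2 + f'
       + 2 * (b' * m1 * m2 + c' * m1 + e' * m2)).
  by rewrite quad_sym3; ring.
have focalE X Y : quad (focal_mx (p1 +i* p2) (q1 +i* q2) k)
      (row3 (m1 + X * e1 - Y * e2) (m2 + X * e2 + Y * e1) 1) =
    - (k * X ^+ 2 + r ^+ 2 * Y ^+ 2 - r ^+ 2 * k).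
  apply: (@mulfI _ 16); first by rewrite pnatr_eq0.
  set x := m1 + _ - _; set y := m2 + _ + _.
  rewrite quad_confocal_mx ?pnatr_eq0 //=.
  have -> : (x - p1) ^+ 2 + (y - p2) ^+ 2 = (X + t) ^+ 2 + Y ^+ 2.
    rewrite -[RHS]mul1r -he /x /y p1E p2E; ring.
  have -> : (x - q1) ^+ 2 + (y - q2) ^+ 2 = (X - t) ^+ 2 + Y ^+ 2.
    rewrite -[RHS]mul1r -he /x /y q1E q2E; ring.
  have -> : 4 * k + (p1 - q1) ^+ 2 + (p2 - q2) ^+ 2 = 4 * r ^+ 2.
    by rewrite rE n2; lra.
  by rewrite kE; ring.
have A0 X Y (hXY : k * X ^+ 2 + r ^+ 2 * Y ^+ 2 = r ^+ 2 * k) :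
    quad (sym3 a b c d e f)
      (row3 (m1 + X * e1 - Y * e2) (m2 + X * e2 + Y * e1) 1) = 0.
  rewrite -AE; apply/on_conicE.
  have := H ((m1 + X * e1 - Y * e2) +i* (m2 + X * e2 + Y * e1)).
  by apply; apply/on_conicE; rewrite focalE hXY subrr oppr0.
have [la hla] := quadratic_through_central_conic r0 k0
  (fun X Y hXY => etrans (esym (quadE a b c d e f X Y)) (A0 X Y hXY)).
exists (- la); rewrite AE scale_sym3; apply: sym3_eq_quad => x y.
pose X := (x - m1) * e1 + (y - m2) * e2; pose Y := (y - m2) * e1 - (x - m1) * e2.
have xE : x = m1 + X * e1 - Y * e2.
  transitivity (m1 + (x - m1) * (e1 ^+ 2 + e2 ^+ 2)); last by rewrite /X /Y; ring.
  by rewrite he; ring.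
have yE : y = m2 + X * e2 + Y * e1.
  transitivity (m2 + (y - m2) * (e1 ^+ 2 + e2 ^+ 2)); last by rewrite /X /Y; ring.
  by rewrite he; ring.
rewrite -scale_sym3 quadZ xE yE.
rewrite -[X in - la * quad X _]/(focal_mx (p1 +i* p2) (q1 +i* q2) k).
by rewrite focalE quadE hla; ring.
Qed.


End FocalSets.

(** * Closed quadrilaterals inscribed in the circle *)

Section Perpendicular.
Variable F : fieldType.

Lemma row3_proportional (u1 u2 u3 w1 w2 w3 : F) : row3 w1 w2 w3 != 0 ->
  u1 * w2 = u2 * w1 -> u1 * w3 = u3 * w1 -> u2 * w3 = u3 * w2 ->
  exists l, row3 u1 u2 u3 = l *: row3 w1 w2 w3.
Proof.
rewrite row3_eq0 !negb_and => h e12 e13 e23.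
case/or3P: h => h.
- exists (u1 / w1); rewrite scale_row3; congr row3; apply: (mulIf h).
  + by rewrite mulfVK.
  + by rewrite -e12 mulrAC mulfVK // mulrC.
  + by rewrite -e13 mulrAC mulfVK // mulrC.
- exists (u2 / w2); rewrite scale_row3; congr row3; apply: (mulIf h).
  + by rewrite e12 mulrAC mulfVK // mulrC.
  + by rewrite mulfVK.
  + by rewrite -e23 mulrAC mulfVK // mulrC.
- exists (u3 / w3); rewrite scale_row3; congr row3; apply: (mulIf h).
  + by rewrite e13 mulrAC mulfVK // mulrC.
  + by rewrite e23 mulrAC mulfVK // mulrC.
  + by rewrite mulfVK.
Qed.

(** The last hypotheses make [w] the cross product of [a] and [b] up to the nonzero factor [k]; only
    its multiples are orthogonal to both. *)
Lemma perp_cross (a1 a2 a3 b1 b2 b3 u1 u2 u3 k w1 w2 w3 : F) :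
  a1 * u1 + a2 * u2 + a3 * u3 = 0 -> b1 * u1 + b2 * u2 + b3 * u3 = 0 ->
  row3 w1 w2 w3 != 0 -> k != 0 ->
  a2 * b3 - a3 * b2 = k * w1 -> a3 * b1 - a1 * b3 = k * w2 ->
  a1 * b2 - a2 * b1 = k * w3 ->
  exists l, row3 u1 u2 u3 = l *: row3 w1 w2 w3.
Proof.
move=> ha hb hw k0 e1 e2 e3; apply: row3_proportional => //; apply: (mulfI k0).
- rewrite ![k * (_ * _)]mulrCA -e1 -e2; apply: subr0_eq.
  transitivity (a3 * (b1 * u1 + b2 * u2 + b3 * u3)
    - b3 * (a1 * u1 + a2 * u2 + a3 * u3)); first by ring.
  by rewrite ha hb !mulr0 subrr.
- rewrite ![k * (_ * _)]mulrCA -e1 -e3; apply: subr0_eq.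
  transitivity (b2 * (a1 * u1 + a2 * u2 + a3 * u3)
    - a2 * (b1 * u1 + b2 * u2 + b3 * u3)); first by ring.
  by rewrite ha hb !mulr0 subrr.
- rewrite ![k * (_ * _)]mulrCA -e2 -e3; apply: subr0_eq.
  transitivity (a1 * (b1 * u1 + b2 * u2 + b3 * u3)
    - b1 * (a1 * u1 + a2 * u2 + a3 * u3)); first by ring.
  by rewrite ha hb !mulr0 subrr.
Qed.

End Perpendicular.

(* Rational parametrisation of the circle: in the isotropic coordinates
   [X + iY], [X - iY], [W] its points are [m ^+ 2], [n ^+ 2], [m * n]. *)
Section Chords.
Variables (F : fieldType) (i : F).
Hypothesis two_neq0 : (2 : F) != 0.
Hypothesis i2 : i ^+ 2 = -1.
Implicit Types x y : F * F.

Definition unit_circle : 'M[F]_3 := sym3 1 0 0 1 0 (-1).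

Definition cpt x : 'rV[F]_3 :=
  row3 ((x.1 ^+ 2 + x.2 ^+ 2) / 2) (- i * (x.1 ^+ 2 - x.2 ^+ 2) / 2)
       (x.1 * x.2).

(** Evaluated at [cpt z] this line gives [pdet z x * pdet z y]. Hence it joins the two points, and
    is the tangent of the circle when they coincide. *)
Definition chord x y : 'rV[F]_3 :=
  row3 (x.2 * y.2 + x.1 * y.1) (i * (x.2 * y.2 - x.1 * y.1))
       (- (x.1 * y.2 + y.1 * x.2)).

Definition veronese x : 'rV[F]_3 := row3 (x.1 ^+ 2) (x.1 * x.2) (x.2 ^+ 2).

(** The binary quadratic form with roots [x] and [y], in coordinates dual to [veronese]. *)
Definition root_form x y : 'rV[F]_3 :=
  row3 (x.2 * y.2) (- (x.1 * y.2 + y.1 * x.2)) (x.1 * y.1).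

Definition pdet x y : F := x.1 * y.2 - y.1 * x.2.

Let i_neq0 : i != 0.
Proof. by apply: contra_eq_neq i2 => ->; rewrite expr0n eq_sym oppr_eq0 oner_eq0. Qed.

Lemma pdet0_prop x y : x != 0 -> y != 0 -> pdet x y = 0 ->
  exists2 t, t != 0 & y = (t * x.1, t * x.2).
Proof.
case: x y => [m n] [m' n'] x0 y0; rewrite /pdet /= => /subr0_eq h.
have [t hm hn] : exists2 t, m' = t * m & n' = t * n.
  have [m0|m0] := eqVneq m 0; last first.
    by exists (m' / m); rewrite ?divfK // mulrAC -h mulrAC divff // mul1r.
  have n0 : n != 0 by apply: contraNneq x0 => n0; rewrite m0 n0.
  exists (n' / n); last by rewrite divfK.
  rewrite m0 mulr0; apply/eqP; move: h; rewrite m0 mul0r => /esym/eqP.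
  by rewrite mulf_eq0 (negPf n0) orbF.
exists t; last by rewrite hm hn.
by apply: contraNneq y0 => t0; rewrite hm hn t0 !mul0r.
Qed.

Lemma chordC x y : chord x y = chord y x.
Proof. by rewrite /chord; congr row3; ring. Qed.

Lemma root_formC x y : root_form x y = root_form y x.
Proof. by rewrite /root_form; congr row3; ring. Qed.

Lemma cpt_chord x y : incident (cpt x) (chord x y).
Proof. by apply/dot_row3_eq0; field: i2. Qed.

Lemma cpt_scale t x : cpt (t * x.1, t * x.2) = t ^+ 2 *: cpt x.
Proof. by rewrite /cpt scale_row3 /=; congr row3; field. Qed.

Lemma chord_scale t x y : chord x (t * y.1, t * y.2) = t *: chord x y.
Proof. by rewrite /chord scale_row3 /=; congr row3; field. Qed.

Lemma prod_neq0 x : (x != 0) = (x.1 != 0) || (x.2 != 0).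
Proof. by case: x => a b; rewrite -negb_and. Qed.

Lemma root_form_neq0 x y : x != 0 -> y != 0 -> root_form x y != 0.
Proof.
rewrite row3_eq0 !prod_neq0 oppr_eq0 => hx hy.
apply/negP => /and3P[/eqP h22 /eqP h12 /eqP h11].
have h1 : x.1 * y.2 = 0.
  apply/eqP; rewrite -[_ == 0](expf_eq0 _ 2); apply/eqP.
  transitivity (x.1 * y.2 * (x.1 * y.2 + y.1 * x.2)
    - (x.1 * y.1) * (x.2 * y.2)); first by ring.
  by rewrite h11 h12 mulr0 mul0r subrr.
have h2 : y.1 * x.2 = 0 by rewrite -h12 h1 add0r.
case/orP: hx => hx; case/orP: hy => hy; have := mulf_neq0 hx hy.
- by rewrite h11 eqxx.
- by rewrite h1 eqxx.
- by rewrite mulrC h2 eqxx.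
- by rewrite h22 eqxx.
Qed.

Lemma chord_neq0 x y : x != 0 -> y != 0 -> chord x y != 0.
Proof.
move=> hx hy; apply: contraNneq (root_form_neq0 hx hy) => /eqP.
rewrite !row3_eq0 mulf_eq0 (negPf i_neq0) /= => /and3P[/eqP h1 /eqP h2 ->].
have h3 : x.2 * y.2 = 0.
  apply: (mulfI two_neq0).
  transitivity ((x.2 * y.2 + x.1 * y.1) + (x.2 * y.2 - x.1 * y.1)).
    by ring.
  by rewrite h1 h2 addr0 mulr0.
by move: h1; rewrite h3 add0r => ->; rewrite eqxx.
Qed.

Lemma cpt_prop x y : x != 0 -> y != 0 -> pdet x y = 0 -> (cpt x == cpt y)%MS.
Proof.
move=> hx hy /(pdet0_prop hx hy) [t t0 ->].
by rewrite cpt_scale; apply/eq_row_scale/expf_neq0.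
Qed.

Lemma chord_prop x y z : y != 0 -> z != 0 -> pdet y z = 0 ->
  (chord x y == chord x z)%MS.
Proof.
move=> hx hy /(pdet0_prop hx hy) [t t0 ->].
by rewrite chord_scale; apply: eq_row_scale.
Qed.

Lemma veronese_prop x y l : veronese x = l *: veronese y -> pdet x y = 0.
Proof.
rewrite scale_row3 => /row3_inj [e1 e2 e3].
apply/eqP; rewrite -[_ == 0](expf_eq0 _ 2); apply/eqP; rewrite /pdet.
transitivity (x.1 ^+ 2 * y.2 ^+ 2 - 2 * (x.1 * x.2) * (y.1 * y.2)
   + x.2 ^+ 2 * y.1 ^+ 2); first by ring.
by rewrite e1 e2 e3; ring.
Qed.

(** For distinct points the line is their cross product. For coinciding points incidence does not
    determine it, and the multiplicity clause of [two_intersections] makes it the tangent. *)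
Lemma line_through x y L : x != 0 -> y != 0 -> L != 0 ->
  two_intersections unit_circle L (cpt x) (cpt y) -> (chord x y == L)%MS.
Proof.
move=> hx hy hL [[ixL iyL] _ _ hT].
suff [l lE] : exists l, L = l *: chord x y.
  rewrite lE; apply: eq_row_scale; apply: contraNneq hL => l0.
  by rewrite lE l0 scale0r.
have [u1 [u2 [u3 LE]]] := row3_eta L; rewrite {}LE in ixL iyL hT hL *.
have [D0|D0] := eqVneq (pdet x y) 0.
  have [t t0 yE] := pdet0_prop hx hy D0.
  have [_ _ /andP[/sub_rVP [l ->] _]] := hT (cpt_prop hx hy D0).
  exists (l / (2 * t)); rewrite yE row3_sym3 !scale_row3.
  by congr row3; rewrite /=; field; rewrite t0.
move/dot_row3_eq0: ixL => ixL; move/dot_row3_eq0: iyL => iyL.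
apply: (perp_cross ixL iyL (chord_neq0 hx hy) (k := - i * pdet x y / 2)).
- by rewrite !mulf_neq0 ?invr_eq0 // oppr_eq0.
- by rewrite /pdet; field: i2.
- by rewrite /pdet; field: i2.
- by rewrite /pdet; field: i2.
Qed.

(** A binary form is determined up to a scalar by its two roots. A double root is expressed by the
    vanishing of both partial derivatives. *)
Lemma quadratic_roots x y (r1 r2 r3 : F) : x != 0 -> y != 0 ->
  (pdet x y != 0 -> r1 * x.1 ^+ 2 + r2 * (x.1 * x.2) + r3 * x.2 ^+ 2 = 0 /\
    r1 * y.1 ^+ 2 + r2 * (y.1 * y.2) + r3 * y.2 ^+ 2 = 0) ->
  (pdet x y = 0 -> 2 * r1 * x.1 + r2 * x.2 = 0 /\ r2 * x.1 + 2 * r3 * x.2 = 0) ->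
  exists l, row3 r1 r2 r3 = l *: root_form x y.
Proof.
move=> hx hy h1 h2; have [D0|D0] := eqVneq (pdet x y) 0.
  have [t t0 yE] := pdet0_prop hx hy D0; have [e1 e2] := h2 D0.
  apply: (perp_cross (a1 := 2 * x.1) (a2 := x.2) (a3 := 0)
    (b1 := 0) (b2 := x.1) (b3 := 2 * x.2) (k := 2 / t)).
  - by rewrite -[RHS]e1; ring.
  - by rewrite -[RHS]e2; ring.
  - exact: root_form_neq0.
  - by rewrite mulf_neq0 ?invr_eq0.
  - by rewrite yE /=; field.
  - by rewrite yE /=; field.
  - by rewrite yE /=; field.
have [e1 e2] := h1 D0.
apply: (perp_cross (a1 := x.1 ^+ 2) (a2 := x.1 * x.2) (a3 := x.2 ^+ 2)
  (b1 := y.1 ^+ 2) (b2 := y.1 * y.2) (b3 := y.2 ^+ 2) (k := pdet x y)) => //.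
- by rewrite -[RHS]e1; ring.
- by rewrite -[RHS]e2; ring.
- exact: root_form_neq0.
all: by rewrite /pdet; ring.
Qed.

Lemma cpt_param (v : 'rV[F]_3) : (forall a : F, exists b, b ^+ 2 = a) ->
  v != 0 -> on_conic unit_circle v -> exists2 x, x != 0 & v = cpt x.
Proof.
move=> sqrtF; have [X [Y [W ->]]] := row3_eta v => v0 /on_conicE.
rewrite quad_sym3 => h.
have [m hm] := sqrtF (X + i * Y); have [n hn] := sqrtF (X - i * Y).
(* The square roots are known up to sign only: the circle equation gives $W=\pm mn$, and replacing
   $n$ by $-n$ corrects the sign. *)
have e : (m * n - W) * (m * n + W) = 0.
  rewrite -[RHS]h; transitivity (m ^+ 2 * n ^+ 2 - W ^+ 2); first by ring.
  by rewrite hm hn; ring: i2.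
have [n' hn' hW] : exists2 n', n' ^+ 2 = X - i * Y & W = m * n'.
  move/eqP: e; rewrite mulf_eq0 subr_eq0 addr_eq0 => /orP[] /eqP e.
    by exists n.
  by exists (- n); rewrite ?sqrrN // mulrN e opprK.
have vE : row3 X Y W = cpt (m, n').
  by rewrite /cpt /= hm hn' hW; congr row3; field: i2.
exists (m, n') => //; apply: contraNneq v0 => -[m0 n0].
by rewrite vE /cpt /= m0 n0 row3_eq0 !expr0n /= addr0 subr0 !mulr0 !mul0r eqxx.
Qed.

End Chords.

(** * The determinant condition imposed by a closed quadrilateral *)

Section PonceletDet.
Variables (F : fieldType) (i : F).
Hypothesis two_neq0 : (2 : F) != 0.
Hypothesis i2 : i ^+ 2 = -1.
Hypothesis sqrtF : forall a : F, exists b, b ^+ 2 = a.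
Variables p1 p2 q1 q2 k : F.
Implicit Types x y : F * F.

Local Notation p := (p1 + i * p2).
Local Notation p' := (p1 - i * p2).
Local Notation q := (q1 + i * q2).
Local Notation q' := (q1 - i * q2).
Local Notation G := (confocal_dual p1 p2 q1 q2 k).
Local Notation A := (confocal_mx p1 p2 q1 q2 k).

(* Two points of the circle with parameters [x], [y] span a tangent of the
   conic iff their Veronese images are orthogonal for this symmetric matrix. *)
Definition chord_mx : 'M[F]_3 :=
  sym3 (p' * q') (- (p' + q')) 1 (2 + p * q' + p' * q - 4 * k) (- (p + q)) (p * q).

Definition chord_det : F :=
  det3 (p' * q') (- (p' + q')) 1 (2 + p * q' + p' * q - 4 * k) (- (p + q)) (p * q).

Lemma chord_mxE x y :
  chord i x y *m G *m (chord i x y)^T =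
  veronese x *m chord_mx *m (veronese y)^T.
Proof.
rewrite confocal_dualE // row3_sym3 dot_row3 /=; congr (_%:M).
by field: i2.
Qed.

(** For fixed [x], [veronese x *m chord_mx] is a binary form whose roots are the other ends of the
    tangent chords from [x]; its polarisation is the pairing by [G] of two chords from [x]. *)
Lemma chord_mx_polar x y z r1 r2 r3 : veronese x *m chord_mx = row3 r1 r2 r3 ->
  chord i x y *m G *m (chord i x z)^T =
  (r1 * y.1 * z.1 + r2 * (y.1 * z.2 + y.2 * z.1) / 2 + r3 * y.2 * z.2)%:M.
Proof.
rewrite row3_sym3 => /row3_inj [<- <- <-].
rewrite confocal_dualE //=; congr (_%:M).
by field: i2.
Qed.

Lemma tangent_line_dual L l : tangent_line (l *: A) L -> L *m G *m L^T = 0.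
Proof.
move=> [P [_ hP /andP[/sub_rVP [t ->] _]]].
have LE : t *: (P *m (l *: A)) = (t * l) *: (P *m A).
  by rewrite -scalemxAr scalerA.
have LT : ((t * l) *: (P *m A))^T = (t * l) *: (A *m P^T).
  by rewrite linearZ /= trmx_mul tr_confocal_mx.
rewrite LE LT -!scalemxAl -!scalemxAr -[P *m A *m G]mulmxA.
rewrite mul_confocal_mx_dual // mul_mx_scalar -scalemxAl mulmxA.
move: hP; rewrite /on_conic -scalemxAr -scalemxAl => hP.
rewrite !scalerA.
rewrite [X in X *: _](_ : _ = t * t * l * confocal_det p1 p2 q1 q2 k * l).
  by rewrite -scalerA hP scaler0.
by ring.
Qed.

(** [L *m G] is a multiple of the point of contact [P], so every line through [P] is conjugate to
    [L]. *)
Lemma tangent_at_dual P L M l : tangent_at (l *: A) P L -> incident P M ->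
  L *m G *m M^T = 0.
Proof.
move=> [_ _ /andP[/sub_rVP [t ->] _]] hM.
rewrite -!scalemxAr -!scalemxAl.
rewrite -[P *m A *m G]mulmxA mul_confocal_mx_dual // mul_mx_scalar -scalemxAl.
by rewrite hM !scaler0.
Qed.

Lemma poncelet4_chord_det l0 (v l : 'I_4 -> 'rV[F]_3) :
  confocal_det p1 p2 q1 q2 k != 0 -> l0 != 0 ->
  poncelet_polygon (unit_circle F) (l0 *: A) v l ->
  ~ trivial_polygon (unit_circle F) (l0 *: A) v l ->
  chord_det = 0.
Proof.
move=> d0 l00 H ntriv; apply/eqP; apply: contra_notT ntriv => chord_det_neq0.
have M1 : chord_mx \in unitmx by apply: unitmx_sym3.
have A1 : A \in unitmx.
  by rewrite unitmxE unitfE det_confocal_mx.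
have /choice [x hx] : forall j, exists y, y != 0 /\ v j = cpt i y.
  move=> j.
  have [v0 _ [_ hv _ _] _] := H j.
  by have [y y0 ->] := cpt_param two_neq0 i2 sqrtF v0 hv; exists y.
have x0 j : x j != 0 by have [] := hx j.
have vE j : v j = cpt i (x j) by have [] := hx j.
have lE j : (chord i (x j) (x (ordS j)) == l j)%MS.
  have [_ lj0 hl _] := H j; rewrite !vE in hl.
  exact: line_through hl.
have l_neq0 j : l j != 0 by have [] := H j.
have lG j : veronese (x j) *m chord_mx *m (veronese (x (ordS j)))^T = 0.
  have [_ _ _ [_ hl _ _]] := H j.
  rewrite -chord_mxE.
  have /andP[/sub_rVP [t ->] _] := lE j.
  rewrite linearZ /= -!scalemxAl -scalemxAr.
  by rewrite (tangent_line_dual hl) !scaler0.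
have lG' j : veronese (x (ordS j)) *m chord_mx *m (veronese (x j))^T = 0.
  apply: trmx_inj; rewrite trmx0 !trmx_mul trmxK tr_sym3 mulmxA.
  exact: lG.
(* If the two neighbours of a vertex coincide, so do the two sides there, and the multiplicity
   clause of [two_tangents] puts the point of contact at that vertex. *)
have ltan j : pdet (x j) (x (ordS (ordS j))) = 0 ->
    tangent_at (l0 *: A) (v (ordS j)) (l j) /\ (l j == l (ordS j))%MS.
  move=> D0; have [_ _ _ [_ _ _ h]] := H j.
  suff ll : (l j == l (ordS j))%MS by split=> //; exact: h.
  have e1 := lE j; rewrite eq_row_sym in e1.
  apply: (eq_row_trans e1); apply: eq_row_trans (lE (ordS j)).
  by rewrite chordC; exact: chord_prop.
(* The binary form attached to a vertex has the two neighbouring vertices as roots, counted with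
   multiplicity. *)
have step j : exists l', veronese (x (ordS j)) *m chord_mx =
    l' *: root_form (x j) (x (ordS (ordS j))).
  have [r1 [r2 [r3 rE]]] := row3_eta (veronese (x (ordS j)) *m chord_mx).
  rewrite rE; apply: quadratic_roots => // D0.
    split.
      by have := lG' j; rewrite rE dot_row3_eq0 => h; rewrite -[RHS]h; ring.
    by have := lG (ordS j); rewrite rE dot_row3_eq0 => h; rewrite -[RHS]h; ring.
  have [ht _] := ltan j D0.
  have hp y : chord i (x (ordS j)) (x j) *m G *m (chord i (x (ordS j)) y)^T = 0.
    have /andP[/sub_rVP [t ce] _] := lE j.
    rewrite chordC ce -!scalemxAl (tangent_at_dual ht) ?scaler0 //.
    by rewrite vE; exact: cpt_chord.
  (* These two choices of [y] extract the two partial derivatives at the double root. *)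
  have := (hp (1, 0), hp (0, 1)); rewrite !(chord_mx_polar _ _ rE) /=.
  move=> [/matrixP/(_ 0 0) h1 /matrixP/(_ 0 0) h2].
  rewrite !mxE !mulr1n in h1 h2.
  split; [rewrite -[RHS](mulr0 2) -[X in _ = 2 * X]h1|
          rewrite -[RHS](mulr0 2) -[X in _ = 2 * X]h2]; by field.
have ordS4 j : ordS (ordS (ordS (ordS j))) = j :> 'I_4.
  by apply/val_inj; case: j => [[|[|[|[|//]]]] hj].
(* Vertices $j+1$ and $j+3$ have the same neighbours, hence proportional images under the invertible
   [chord_mx]. *)
have D1 j : pdet (x (ordS j)) (x (ordS (ordS (ordS j)))) = 0.
  have [l1 e1] := step j; have [l2 e2] := step (ordS (ordS j)).
  rewrite ordS4 root_formC in e2.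
  have l20 : l2 != 0.
    apply: contraNneq (x0 (ordS (ordS (ordS j)))) => l20.
    move: e2; rewrite l20 scale0r => /(congr1 (mulmx^~ (invmx chord_mx))).
    rewrite mulmxK // mul0mx => /eqP; rewrite row3_eq0 !expf_eq0 /= => /and3P[h1 _ h2].
    by apply/eqP; move: h1 h2; case: (x _) => ? ? /= /eqP -> /eqP ->.
  have : veronese (x (ordS j)) =
      (l1 / l2) *: veronese (x (ordS (ordS (ordS j)))).
    rewrite -[LHS](mulmxK M1) e1 -[veronese _](mulmxK M1) e2.
    by rewrite -!scalemxAl !scalerA mulfVK.
  exact: veronese_prop.
have D0 j : pdet (x j) (x (ordS (ordS j))) = 0.
  by have := D1 (ordS (ordS (ordS j))); rewrite ordS4.
have B1 : l0 *: A \in unitmx by rewrite unitmxZ // unitfE.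
have tanB j : tangent_at (l0 *: A) (v (ordS j)) (l j) by have [] := ltan j (D0 j).
have ll j : (l j == l (ordS j))%MS by have [] := ltan j (D0 j).
(* Each vertex is the pole of a side tangent there, and consecutive sides agree, so consecutive
   vertices agree and the polygon is constant. *)
have vv' j : (v (ordS j) == v (ordS (ordS j)))%MS.
  have [_ _ h1] := tanB j; have [_ _ h2] := tanB (ordS j).
  rewrite eq_row_sym in h1.
  have := eq_row_trans (eq_row_trans h1 (ll j)) h2.
  by move/(eq_row_mulr (invmx (l0 *: A))); rewrite !mulmxK.
have vv j : (v j == v (ordS j))%MS.
  by have := vv' (ordS (ordS (ordS j))); rewrite ordS4.
have [_ _ [_ _ _ tanT] _] := H ord0.
exists (v ord0), (l ord0); split; first exact/tanT/vv.
  have [h1 h2 h3] := tanB (ordS (ordS (ordS ord0))).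
  have := ll (ordS (ordS (ordS ord0))); rewrite ordS4 in h1 h2 h3 *.
  by rewrite eq_row_sym => ll3; split=> //; apply: eq_row_trans h3.
have ind (u : 'I_4 -> 'rV[F]_3) : (forall j, (u j == u (ordS j))%MS) ->
    forall j, (u j == u ord0)%MS.
  move=> hu j; have hu' j' : (u (ordS j') == u j')%MS.
    by rewrite eq_row_sym; exact: hu.
  have h1 := hu' ord0; have h2 := eq_row_trans (hu' (ordS ord0)) h1.
  have h3 := eq_row_trans (hu' (ordS (ordS ord0))) h2.
  case: j => [[|[|[|[|//]]]] hj].
  - by rewrite (_ : Ordinal hj = ord0) ?submx_refl //; apply: val_inj.
  - by rewrite (_ : Ordinal hj = ordS ord0) //; apply: val_inj.
  - by rewrite (_ : Ordinal hj = ordS (ordS ord0)) //; apply: val_inj.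
  - by rewrite (_ : Ordinal hj = ordS (ordS (ordS ord0))) //; apply: val_inj.
by move=> j; split; apply: ind.
Qed.


End PonceletDet.

Section ChordDet.
Variables (F : fieldType) (i : F).
Hypothesis i2 : i ^+ 2 = -1.

(** [k] enters [chord_mx] only through the central entry, so the determinant is affine in [k]. *)
Lemma chord_detE (p1 p2 q1 q2 k : F) : chord_det i p1 p2 q1 q2 k =
  4 * (1 - (p1 ^+ 2 + p2 ^+ 2) * (q1 ^+ 2 + q2 ^+ 2)) * k
  - 2 * ((1 - (p1 ^+ 2 + p2 ^+ 2)) * (1 - (q1 ^+ 2 + q2 ^+ 2))
         * (1 - (p1 * q1 + p2 * q2))).
Proof. by rewrite /chord_det /det3; ring: i2. Qed.

End ChordDet.

(** * The one admissible member of the confocal family *)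

Section PonceletParameter.
Variable R : realType.
Implicit Types (p q z : R[i]) (s k : R) (S : set R[i]).

Local Notation Re := complex.Re.
Local Notation Im := complex.Im.

(** The zero of [chord_det] as a function of [k]: the square of the semi-minor axis of the conic
    sought. *)
Definition poncelet_minor p q : R :=
  (1 - nrm p ^+ 2) * (1 - nrm q ^+ 2) * (1 - (Re p * Re q + Im p * Im q))
  / (2 * (1 - nrm p ^+ 2 * nrm q ^+ 2)).

Definition poncelet_conic p q : set R[i] :=
  [set z | on_conic (focal_mx p q (poncelet_minor p q)) (affine_point z)].

Lemma nrm_lt1 p : `|p| < 1 -> nrm p ^+ 2 < 1.
Proof.
rewrite normE -(rmorph1 (real_complex R)) ltcR => h.
by rewrite expr_lt1 // nrm_ge0.
Qed.

Lemma nrm_mul_lt1 p q : `|p| < 1 -> `|q| < 1 ->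
  0 < 1 - nrm p ^+ 2 * nrm q ^+ 2.
Proof.
move=> /nrm_lt1 hp /nrm_lt1 hq; rewrite subr_gt0.
by rewrite mulr_ilt1 // exprn_ge0 // nrm_ge0.
Qed.

Lemma poncelet_minor_gt0 p q : `|p| < 1 -> `|q| < 1 -> 0 < poncelet_minor p q.
Proof.
move=> hp hq; have := nrm_lt1 hp; have := nrm_lt1 hq.
have := nrm_sqr p; have := nrm_sqr q => eq' ep' hq1 hp1.
rewrite divr_gt0 //; last by rewrite mulr_gt0 // nrm_mul_lt1.
rewrite !mulr_gt0 ?subr_gt0 //.
have := sqr_ge0 (Re p - Re q); have := sqr_ge0 (Im p - Im q).
by lra.
Qed.

Lemma poncelet_conic_ellipse p q : `|p| < 1 -> `|q| < 1 ->
  ellipse_with_foci p q (poncelet_conic p q).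
Proof.
move=> hp hq; have k0 := poncelet_minor_gt0 hp hq.
pose s2 := 4 * poncelet_minor p q + nrm (p - q) ^+ 2.
have s2_gt : nrm (p - q) ^+ 2 < s2 by rewrite /s2; lra.
have s2_ge0 : 0 <= s2 by apply: ltW; apply: le_lt_trans s2_gt; exact: sqr_ge0.
have hs : nrm (p - q) < Num.sqrt s2.
  by rewrite -[ltLHS]ger0_norm ?nrm_ge0 // -sqrtr_sqr ltr_sqrt // (le_lt_trans _ s2_gt) ?sqr_ge0.
exists (Num.sqrt s2); first by rewrite normE ltcR.
by rewrite (@ellipse_setE _ p q (poncelet_minor p q)) // sqr_sqrtr // /s2; ring.
Qed.

(** $k=(s^2-|p-q|^2)/4$ is positive for an ellipse and negative for a hyperbola; the second
    condition records $s^2>0$. *)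
Lemma conic_with_foci_focal p q S : conic_with_foci p q S ->
  exists k, [/\ k != 0, 0 < 4 * k + nrm (p - q) ^+ 2
    & S = [set z | on_conic (focal_mx p q k) (affine_point z)]].
Proof.
have n0 := nrm_ge0 (p - q).
case=> -[s]; rewrite normE -?(rmorph0 (real_complex R)) !ltcR => hs ->;
  exists ((s ^+ 2 - nrm (p - q) ^+ 2) / 4).
  have lt2 : nrm (p - q) ^+ 2 < s ^+ 2 by rewrite ltr_sqr // nnegrE; lra.
  split; [by apply/negP => /eqP; lra|by have := sqr_ge0 (nrm (p - q)); lra|].
  by apply: ellipse_setE => //; field.
case/andP: hs => s0 hs.
have lt2 : s ^+ 2 < nrm (p - q) ^+ 2 by rewrite ltr_sqr // nnegrE; lra.
have s20 : 0 < s ^+ 2 by rewrite exprn_gt0.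
split; [by apply/negP => /eqP; lra|by lra|].
by apply: hyperbola_setE; [field|rewrite s0].
Qed.

Lemma map_sym3 (a b c d e f : R) : map_mx (real_complex R) (sym3 a b c d e f) =
  sym3 a%:C b%:C c%:C d%:C e%:C f%:C.
Proof.
apply/matrixP => i j; rewrite !mxE.
by case: i j => [[|[|[|//]]] hi] [[|[|[|//]]] hj].
Qed.

Lemma map_focal_mx p q k : map_mx (real_complex R) (focal_mx p q k) =
  confocal_mx (Re p)%:C (Im p)%:C (Re q)%:C (Im q)%:C k%:C.
Proof.
rewrite map_sym3 /confocal_mx /adj3.
by rewrite !(rmorphB, rmorphM, rmorphD, rmorphXn, rmorph1, fmorphV, rmorph_nat).
Qed.

Lemma circle_mxE : circle_mx R = unit_circle R.
Proof.
apply/matrixP => i j; rewrite !mxE.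
by case: i j => [[|[|[|//]]] hi] [[|[|[|//]]] hj]; rewrite /= ?mulr1n ?mulr0n.
Qed.

Lemma map_circle_mx : map_mx (real_complex R) (circle_mx R) = unit_circle R[i].
Proof. by rewrite circle_mxE map_sym3 rmorph0 rmorphN rmorph1. Qed.

Lemma poncelet4_minor p q k : `|p| < 1 -> `|q| < 1 ->
  k != 0 -> 0 < 4 * k + nrm (p - q) ^+ 2 ->
  poncelet_inscribed 4
    [set z | on_conic (focal_mx p q k) (affine_point z)] ->
  k = poncelet_minor p q.
Proof.
move=> hp hq k0 ks [A [[At dA SE]] /=].
(* [A] is an arbitrary matrix with the given zero set; it is a multiple of the focal one, to which
   the determinant condition applies. *)
have [|l l0 AE] := focal_mx_uniq k0 ks At dA.
  by move=> z hz; have : [set z | on_conic A (affine_point z)] z by rewrite -SE.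
rewrite AE map_mxZ map_focal_mx map_circle_mx => -[v [e [H ntriv]]].
have two_neq0 : (2 : R[i]) != 0 by rewrite pnatr_eq0.
have i2 : (0 +i* 1 : R[i]) ^+ 2 = -1 by rewrite expr2; simpc.
have sqrtF (a : R[i]) : exists b, b ^+ 2 = a.
  by exists (sqrtC a); rewrite sqrtCK.
have := poncelet4_chord_det two_neq0 i2 sqrtF _ _ H ntriv.
have det_neq0 : confocal_det (Re p)%:C (Im p)%:C (Re q)%:C (Im q)%:C k%:C != 0.
  rewrite /confocal_det.
  rewrite -(rmorph_nat (real_complex R)) -!(fmorphV, rmorphB, rmorphXn).
  rewrite -!(rmorphB, rmorphM, rmorphD, rmorphXn) fmorph_eq0 mulf_neq0 //.
  move: ks; rewrite nrm_sqr Re_sub Im_sub => ks.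
  by apply/negP => /eqP; lra.
rewrite fmorph_eq0 => /(_ det_neq0 l0); rewrite chord_detE //.
rewrite -(rmorph1 (real_complex R)) -!(rmorph_nat (real_complex R)).
rewrite -!(rmorphXn, rmorphM, rmorphD, rmorphB) -(rmorph0 (real_complex R)).
rewrite -!nrm_sqr => /complexI h.
rewrite /poncelet_minor; have := nrm_mul_lt1 hp hq => n0.
apply: (@mulIf _ (2 * (1 - nrm p ^+ 2 * nrm q ^+ 2))).
  by rewrite mulf_neq0 ?pnatr_eq0 // gt_eqF.
rewrite divfK; last by rewrite mulf_neq0 ?pnatr_eq0 // gt_eqF.
by rewrite nrm_sqr in h *; lra.
Qed.

End PonceletParameter.

(** * Lifting Blaschke products to the line *)

Section Calculus.
Variable R : realType.
Implicit Types (f g df : R -> R) (x y : R).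

Lemma is_derive_ratio f g x a b : g x != 0 ->
  is_derive x 1 f a -> is_derive x 1 g b ->
  is_derive x 1 (fun t => f t / g t) ((a * g x - f x * b) / g x ^+ 2).
Proof.
move=> g0 df dg.
have dV : is_derive x 1 (fun t => (g t)^-1) (- (g x) ^- 2 * b).
  apply: DeriveDef; first exact: derivableV.
  by rewrite deriveV // derive_val.
have := is_deriveM df dV; move=> h; apply: is_derive_eq h _.
by rewrite /GRing.scale /=; field.
Qed.

Lemma is_derive_increasing f df :
  (forall x, is_derive x 1 f (df x)) -> (forall x, 0 < df x) ->
  {homo f : x y / x < y}.
Proof.
move=> fD df0 x y xy.
have [//|c _ h] := @MVT R f df x y xy (fun x _ => fD x).
  by apply: derivable_within_continuous => z _; apply: ex_derive.
by rewrite -subr_gt0 h mulr_gt0 // subr_gt0.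
Qed.

Lemma is_derive_continuous f df :
  (forall x, is_derive x 1 f (df x)) -> continuous f.
Proof.
by move=> fD x; apply/differentiable_continuous/derivable1_diffP/ex_derive.
Qed.

Lemma increasing_onto f df (c M : R) : 0 < c ->
  (forall x, is_derive x 1 f (df x)) ->
  (forall x, `|f x - c * x| <= M) -> forall y, exists x, f x = y.
Proof.
move=> c0 fD fM y.
pose a := (y - M) / c; pose b := (y + M) / c.
have M0 : 0 <= M by apply: le_trans (fM 0); exact: normr_ge0.
have ca : c * a = y - M by rewrite mulrC divfK // gt_eqF.
have cb : c * b = y + M by rewrite mulrC divfK // gt_eqF.
have ab : a <= b by rewrite ler_pM2r ?invr_gt0 //; lra.
have := fM a; rewrite ler_norml ca => /andP[ha1 ha2].
have := fM b; rewrite ler_norml cb => /andP[hb1 hb2].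
have [||x _ <-] := @IVT R f a b y ab; last by exists x.
- by apply: derivable_within_continuous => z _; apply: ex_derive.
- by rewrite ge_min le_max; apply/andP; split; apply/orP; [left|right]; lra.
Qed.

End Calculus.

Section CirclePoint.
Variable R : realType.
Implicit Types (x y t : R).

Local Notation E := (@circle_point R).

Lemma circle_pointD x y : E (x + y) = E x * E y.
Proof. by rewrite /circle_point cosD sinD; simpc; rewrite [_ + cos x * _]addrC. Qed.

Lemma circle_pointN x : E (- x) = (E x)^*.
Proof. by rewrite /circle_point cosN sinN. Qed.

Lemma circle_point_conj x : E x * (E x)^* = 1.
Proof.
rewrite -circle_pointN -circle_pointD subrr /circle_point.
by rewrite cos0 sin0.
Qed.

Lemma circle_point_neq0 x : E x != 0.
Proof.
apply: contra_eq_neq (circle_point_conj x) => ->.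
by rewrite mul0r eq_sym oner_eq0.
Qed.

Lemma circle_point2pi x : E (x + pi *+ 2) = E x.
Proof. by rewrite /circle_point cosD2pi sinD2pi. Qed.

Lemma circle_point2piz x (k : int) : E (x + (pi *+ 2) *~ k) = E x.
Proof.
have h n y : E (y + (pi *+ 2) *+ n) = E y.
  elim: n y => [|n IH] y; first by rewrite mulr0n addr0.
  by rewrite mulrS addrA IH circle_point2pi.
case: k => n; first exact: h.
rewrite NegzE mulrNz -pmulrn.
by have := h n.+1 (x - (pi *+ 2) *+ n.+1); rewrite subrK.
Qed.

(** Removing whole periods leaves [r] in $[0,2\pi)$ with $\cos r=1$. If $r>0$, the half-angle
    formula gives $\sin(r/2)=0$ with $0<r/2<\pi$, which is absurd. *)
Lemma circle_point_inj x y : E x = E y -> exists k : int, x = y + (pi *+ 2) *~ k.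
Proof.
move=> h; pose T : R := pi *+ 2; have T0 : 0 < T by rewrite pmulrn_lgt0 ?pi_gt0.
pose k := Num.floor ((x - y) / T); exists k.
pose r := x - y - T *~ k.
have rE : r = ((x - y) / T - k%:~R) * T.
  by rewrite mulrBl divfK ?gt_eqF // mulrzl.
have /andP[r1 r2] : k%:~R <= (x - y) / T < (k + 1)%:~R.
  by apply: real_floor_itv; apply: num_real.
have r_ge0 : 0 <= r by rewrite rE mulr_ge0 ?subr_ge0 // ltW.
have r_lt : r < T.
  by rewrite rE -[ltRHS]mul1r ltr_pM2r // ltrBlDl -intrD1.
have cr : cos r = 1.
  have e1 : E r = 1.
    rewrite /r -mulrNz circle_point2piz circle_pointD circle_pointN h.
    exact: circle_point_conj.
  by have := congr1 (@complex.Re R) e1.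
suff r0 : r = 0 by move: r0; rewrite /r => /eqP; rewrite !subr_eq add0r addrC => /eqP ->; rewrite addrC.
apply/eqP; case: (ltrP 0 r) => [rp|]; last by rewrite eq_le r_ge0 => ->.
have : 0 < sin (r / 2).
  apply: sin_gt0_pi; rewrite divr_gt0 //= ltr_pdivrMr //.
  by rewrite mulr_natr.
move=> s0; have := cos_mulr2n (r / 2).
have -> : (r / 2) *+ 2 = r by rewrite -mulr_natr divfK ?pnatr_eq0.
rewrite cr cos2sin2 => e.
have : sin (r / 2) ^+ 2 = 0 by lra.
by move=> /eqP; rewrite sqrf_eq0 gt_eqF.
Qed.

End CirclePoint.

(** * Increasing arguments of single Blaschke factors *)

Section BlaschkeAngle.
Variable R : realType.
Implicit Types (a z : R[i]) (t x y : R).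

Local Notation Re := complex.Re.
Local Notation Im := complex.Im.
Local Notation E := (@circle_point R).

Definition den_re a t : R := 1 - Re a * cos t - Im a * sin t.
Definition den_im a t : R := Im a * cos t - Re a * sin t.

(* With [w = 1 - a^* E t], whose real part is positive, the Blaschke factor of
   [a] at [E t] is [- E t * w^* / w]. *)
Definition blaschke_angle a t : R := t - 2 * atan (den_im a t / den_re a t).

(** The Poisson kernel $(1-|a|^2)/|1-\bar a e^{it}|^2$. *)
Definition blaschke_angle' a t : R :=
  (1 - nrm a ^+ 2) / (den_re a t ^+ 2 + den_im a t ^+ 2).

Lemma den_re_gt0 a t : `|a| < 1 -> 0 < den_re a t.
Proof.
move=> /nrm_lt1; rewrite nrm_sqr /den_re => ha.
have := cos2Dsin2 t; set c := cos t; set s := sin t => cs.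
have := sqr_ge0 (Re a - c); have := sqr_ge0 (Im a - s).
by lra.
Qed.

Lemma den_norm_gt0 a t : `|a| < 1 -> 0 < den_re a t ^+ 2 + den_im a t ^+ 2.
Proof.
by move=> ha; rewrite ltr_wpDr ?sqr_ge0 // exprn_gt0 // den_re_gt0.
Qed.

(** The right-hand side is $(D+iN)^2/|D+iN|^2$, the point of the circle with twice the argument of
    $D+iN$. *)
Lemma circle_point_double_atan (D N : R) : D != 0 ->
  E (2 * atan (N / D)) =
  ((D ^+ 2 - N ^+ 2) / (D ^+ 2 + N ^+ 2)) +i* (2 * D * N / (D ^+ 2 + N ^+ 2)).
Proof.
move=> D0; set ph := atan _.
have W0 : D ^+ 2 + N ^+ 2 != 0.
  by rewrite paddr_eq0 ?sqr_ge0 // !sqrf_eq0 (negPf D0).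
have c2 : cos ph ^+ 2 = D ^+ 2 / (D ^+ 2 + N ^+ 2).
  rewrite cos_atan exprVn sqr_sqrtr; last by rewrite addr_ge0 ?sqr_ge0.
  have -> : 1 + (N / D) ^+ 2 = (D ^+ 2 + N ^+ 2) / D ^+ 2 by field.
  by rewrite invf_div.
have cph : cos ph != 0.
  by rewrite gt_eqF // cos_atan invr_gt0 sqrtr_gt0 ltr_wpDr ?sqr_ge0.
have sE : sin ph = N / D * cos ph.
  by rewrite -[N / _]atanK /tan divfK.
rewrite mulr_natl /circle_point cos_mulr2n sin_mulr2n sE mulrCA -expr2 c2.
by congr (_ +i* _); rewrite ?mulr2n; field; rewrite ?W0 ?D0.
Qed.

Lemma blaschke_factor_angle a t : `|a| < 1 ->
  blaschke_factor a (E t) = - E (blaschke_angle a t).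
Proof.
move=> ha; have D0 := den_re_gt0 t ha; have w0 := den_norm_gt0 t ha.
have Dn0 : den_re a t != 0 by rewrite gt_eqF.
have Wn0 : den_re a t ^+ 2 + den_im a t ^+ 2 != 0 by rewrite gt_eqF.
have wE : 1 - E t * a^* = den_re a t +i* den_im a t.
  rewrite /den_re /den_im; case: (a) => a1 a2; rewrite /circle_point.
  rewrite -[(_ +i* _)^*]/(_ -i* _) -[1]/(1 +i* 0); simpc => /=.
  by congr (_ +i* _); ring.
have zwE : a - E t = - (E t * (den_re a t -i* den_im a t)).
  rewrite /den_re /den_im; case: (a) => a1 a2; rewrite /circle_point /=; simpc.
  have sc : sin t ^+ 2 = 1 - cos t ^+ 2 by rewrite -(cos2Dsin2 t); ring.
  by congr (_ +i* _); ring: sc.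
have nz : 1 - E t * a^* != 0.
  by rewrite wE; apply/negP => /eqP [h _]; rewrite h eqxx in Dn0.
rewrite /blaschke_factor; apply: (mulIf nz); rewrite divfK //.
rewrite /blaschke_angle circle_pointD circle_pointN circle_point_double_atan //.
rewrite wE zwE mulNr -[E t * _ * _]mulrA; congr (- (_ * _)).
move: (den_re a t) (den_im a t) Dn0 Wn0 => D N Dn0 Wn0.
rewrite -[(_ +i* _)^*]/(_ -i* _); simpc.
by congr (_ +i* _); field.
Qed.

Lemma is_derive_blaschke_angle a t : `|a| < 1 ->
  is_derive t 1 (blaschke_angle a) (blaschke_angle' a t).
Proof.
move=> ha; have D0 := den_re_gt0 t ha; have w0 := den_norm_gt0 t ha.
have Dn0 : den_re a t != 0 by rewrite gt_eqF.
have Wn0 : den_re a t ^+ 2 + den_im a t ^+ 2 != 0 by rewrite gt_eqF.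
have dre : is_derive t 1 (den_re a) (Re a * sin t - Im a * cos t).
  rewrite /den_re; apply: is_derive_eq.
  by rewrite /GRing.scale /=; ring.
have dim : is_derive t 1 (den_im a) (- Im a * sin t - Re a * cos t).
  rewrite /den_im; apply: is_derive_eq.
  by rewrite /GRing.scale /=; ring.
have dr := is_derive_ratio Dn0 dim dre.
have da := is_derive1_comp (is_derive1_atan _) dr.
have := is_deriveB (is_derive_id t 1) (is_deriveZ 2 da) => h.
apply: is_derive_eq h _.
rewrite /GRing.scale /= /blaschke_angle' nrm_sqr.
have cs := cos2Dsin2 t.
(* This is $|a|^2=|1-w|^2$ for $w=1-\bar a e^{it}$. *)
have e : Re a ^+ 2 + Im a ^+ 2 = 1 - 2 * den_re a t + (den_re a t ^+ 2 + den_im a t ^+ 2).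
  have sc : sin t ^+ 2 = 1 - cos t ^+ 2 by rewrite -cs; ring.
  by rewrite /den_re /den_im; ring: sc.
rewrite e.
have -> : Re a * sin t - Im a * cos t = - den_im a t by rewrite /den_im; ring.
have -> : - Im a * sin t - Re a * cos t = den_re a t - 1 by rewrite /den_re; ring.
move: (den_re a t) (den_im a t) Dn0 Wn0 => D N Dn0 Wn0.
have -> : 1 + (N / D) ^+ 2 = (D ^+ 2 + N ^+ 2) / D ^+ 2 by field.
by rewrite invf_div; field; rewrite Dn0 Wn0.
Qed.

Lemma blaschke_angle'_gt0 a t : `|a| < 1 -> 0 < blaschke_angle' a t.
Proof.
move=> ha; rewrite divr_gt0 ?den_norm_gt0 // subr_gt0; exact: nrm_lt1.
Qed.

Lemma blaschke_angle_homo a : `|a| < 1 -> {homo blaschke_angle a : x y / x < y}.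
Proof.
move=> ha; apply: (is_derive_increasing (df := blaschke_angle' a)) => t.
  exact: is_derive_blaschke_angle.
exact: blaschke_angle'_gt0.
Qed.

Lemma blaschke_angle2pi a t : blaschke_angle a (t + pi *+ 2) =
  blaschke_angle a t + pi *+ 2.
Proof. by rewrite /blaschke_angle /den_im /den_re cosD2pi sinD2pi addrAC. Qed.

Lemma blaschke_angle_bound a t : `|blaschke_angle a t - t| <= pi.
Proof.
rewrite /blaschke_angle; set u := atan _.
have := atan_gtNpi2 (den_im a t / den_re a t); have := atan_ltpi2 (den_im a t / den_re a t).
by rewrite -/u ler_norml => *; lra.
Qed.

End BlaschkeAngle.

(* [b x / b y - 1], with [b] the Blaschke product with zeros [0, c, p, q],
   factors into the three ways in which [b x = b y]: the points agree, they are
   opposite vertices (their chord passes through [c]), or they are adjacent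
   (their chord is tangent to the conic). *)
Lemma blaschke4_factorization (F : fieldType) (p p' q q' c c' k x y : F) :
  1 - p * p' * (q * q') != 0 ->
  c * (1 - p * p' * (q * q')) = p + q - p * q * (p' + q') ->
  c' * (1 - p * p' * (q * q')) = p' + q' - p' * q' * (p + q) ->
  k * (1 - p * p' * (q * q')) =
    (1 - p * p') * (1 - q * q') * (2 - p * q' - p' * q) ->
  x * (c - x) * (p - x) * (q - x) * ((1 - y * c') * (1 - y * p') * (1 - y * q'))
  - y * (c - y) * (p - y) * (q - y) * ((1 - x * c') * (1 - x * p') * (1 - x * q'))
  = - (x - y) * (x + y - c - c' * (x * y))
    * ((p - (x + y) + x * y * p') * (q - (x + y) + x * y * q') - k * (x * y)).
Proof.
move=> n0 hc hc' hk.
have -> : c = (p + q - p * q * (p' + q')) / (1 - p * p' * (q * q')).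
  by rewrite -hc mulfK.
have -> : c' = (p' + q' - p' * q' * (p + q)) / (1 - p * p' * (q * q')).
  by rewrite -hc' mulfK.
have -> : k = (1 - p * p') * (1 - q * q') * (2 - p * q' - p' * q)
     / (1 - p * p' * (q * q')) by rewrite -hk mulfK.
by field.
Qed.

(** Primed variables stand for conjugates; [c'] is eliminated between the equation of the center and
    its conjugate. *)
Lemma blaschke_center_solve (F : fieldType) (p p' q q' c c' : F) :
  c - p = q * (1 - p * c') -> c' - p' = q' * (1 - p' * c) ->
  c * (1 - p * p' * (q * q')) = p + q - p * q * (p' + q').
Proof.
move=> h1 h2; have e1 : c = p + q * (1 - p * c') by rewrite -h1; ring.
have e2 : c' = p' + q' * (1 - p' * c) by rewrite -h2; ring.
by rewrite mulrBr mulr1 {1}e1 e2; ring.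
Qed.

Lemma ler_mulrz_gt0 (R : realType) (T : R) (k : int) :
  0 < T -> 0 < T *~ k -> T <= T *~ k.
Proof.
move=> T0; rewrite -mulrzl pmulr_lgt0 // ltr0z => k0.
by rewrite ler_peMl ?(ltW T0) // ler1z -gtz0_ge1.
Qed.

(** * The lifted Blaschke product and its consecutive solutions *)

Section BlaschkeLift.
Variable R : realType.
Variables p q : R[i].
Hypotheses (hp : `|p| < 1) (hq : `|q| < 1).
Implicit Types (t x y : R) (u v : R[i]).

Local Notation Re := complex.Re.
Local Notation Im := complex.Im.
Local Notation E := (@circle_point R).
Local Notation c := (blaschke_center p q).

Let hc : `|c| < 1. Proof. by have [] := blaschke_centerP hp hq. Qed.

(** For distinct points of the circle, the first two factors vanish when the chord passes through
    [p], respectively [q]. The whole is the dual conic at the chord, up to a constant and a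
    unimodular factor. *)
Definition tangent_form u v : R[i] :=
  (p - (u + v) + u * v * p^*) * (q - (u + v) + u * v * q^*)
  - (4 * poncelet_minor p q)%:C * (u * v).

Lemma nrm_conj (z : R[i]) : z * z^* = (nrm z ^+ 2)%:C.
Proof.
rewrite nrm_sqr; case: z => a b /=; rewrite -[(a +i* b)^*]/(a -i* b).
by simpc; congr (_ +i* _); ring.
Qed.

Lemma circle_den_neq0 z a : `|a| < 1 -> 1 - E z * a^* != 0.
Proof.
move=> ha; apply/negP => /eqP /subr0_eq h.
have : `|E z * a^*| < 1.
  rewrite normrM norm_conjC (_ : `|E z| = 1) ?mul1r //.
  apply/eqP; rewrite -sqrp_eq1 ?normr_ge0 // normCK.
  by rewrite circle_point_conj.
by rewrite -h normr1 ltxx.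
Qed.


(** Clearing denominators brings [blaschke4_factorization] to bear, with conjugates as primed
    variables and [4 * poncelet_minor p q] as its [k]. *)
Lemma blaschke4_eq_circle x y : blaschke4 p q (E x) = blaschke4 p q (E y) ->
  [\/ E x = E y, E x + E y - c - c^* * (E x * E y) = 0
    | tangent_form (E x) (E y) = 0].
Proof.
have den := circle_den_neq0.
have n0 : 1 - p * p^* * (q * q^*) != 0.
  rewrite !nrm_conj -rmorphM -(rmorph1 (real_complex R)) -rmorphB fmorph_eq0.
  by rewrite gt_eqF // nrm_mul_lt1.
have cE : c - p = q * (1 - p * c^*).
  have [_ /(congr1 (fun z => z * (1 - p * c^*))) <-] := blaschke_centerP hp hq.
  by rewrite divfK // blaschke_den_neq0.
have cE' : c^* - p^* = q^* * (1 - p^* * c).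
  rewrite -rmorphB cE !(rmorphM, rmorphB, rmorph1) /=.
  by rewrite conjCK.
have hcn := blaschke_center_solve cE cE'.
have hcn' : c^* * (1 - p * p^* * (q * q^*)) = p^* + q^* - p^* * q^* * (p + q).
  by rewrite -(blaschke_center_solve cE' cE); ring.
have hk : (4 * poncelet_minor p q)%:C * (1 - p * p^* * (q * q^*)) =
    (1 - p * p^*) * (1 - q * q^*) * (2 - p * q^* - p^* * q).
  have -> : 2 - p * q^* - p^* * q = (2 - 2 * (Re p * Re q + Im p * Im q))%:C.
    rewrite -(rmorph_nat (real_complex R)).
    case: (p) (q) => p1 p2 [q1 q2]; rewrite -!/(_ -i* _).
    rewrite -[(p1 +i* p2)^*]/(p1 -i* p2) -[(q1 +i* q2)^*]/(q1 -i* q2); simpc => /=.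
    by congr (_ +i* _); ring.
  rewrite !nrm_conj -(rmorph1 (real_complex R)) -!(rmorphM, rmorphB).
  rewrite /poncelet_minor.
  have n1 : 1 - nrm p ^+ 2 * nrm q ^+ 2 != 0.
    by rewrite gt_eqF // nrm_mul_lt1.
  by congr (_%:C); field; rewrite exprMn.
move=> h.
pose num z := z * (c - z) * (p - z) * (q - z).
pose dnm z := (1 - z * c^*) * (1 - z * p^*) * (1 - z * q^*).
have BE z : blaschke4 p q (E z) * dnm (E z) = num (E z).
  rewrite /blaschke4 /blaschke_factor /dnm /num.
  by field; rewrite !den.
have e0 : num (E x) * dnm (E y) - num (E y) * dnm (E x) = 0.
  by rewrite -!BE h; ring.
have := blaschke4_factorization (E x) (E y) n0 hcn hcn' hk.
rewrite -/(num _) -/(num _) -/(dnm _) -/(dnm _) e0 => /esym/eqP.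
rewrite -/(tangent_form (E x) (E y)).
rewrite !mulf_eq0 oppr_eq0 subr_eq0 => /orP[/orP[]|] /eqP e.
- by constructor 1.
- by constructor 2.
- by constructor 3.
Qed.

(** A differentiable argument of $-B(e^{it})$; each of the three nontrivial factors contributes a
    sign. *)
Definition blaschke_lift t : R :=
  t + blaschke_angle c t + (blaschke_angle p t + blaschke_angle q t).

Definition blaschke_lift' t : R :=
  1 + blaschke_angle' c t + (blaschke_angle' p t + blaschke_angle' q t).

Local Notation th := blaschke_lift.

Lemma blaschke4_lift t : blaschke4 p q (E t) = - E (th t).
Proof.
rewrite /blaschke4 !blaschke_factor_angle // /blaschke_lift !circle_pointD.
by ring.
Qed.

Lemma is_derive_blaschke_lift t : is_derive t 1 th (blaschke_lift' t).
Proof.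
have d a : `|a| < 1 -> is_derive t 1 (blaschke_angle a) (blaschke_angle' a t).
  exact: is_derive_blaschke_angle.
exact: is_deriveD (is_deriveD (is_derive_id t 1) (d _ hc))
                  (is_deriveD (d _ hp) (d _ hq)).
Qed.

Lemma blaschke_lift'_gt0 t : 0 < blaschke_lift' t.
Proof. by rewrite /blaschke_lift' !addr_gt0 ?blaschke_angle'_gt0. Qed.

Lemma blaschke_lift_mono : {mono th : x y / x < y}.
Proof.
apply/leW_mono/le_mono.
exact: is_derive_increasing is_derive_blaschke_lift blaschke_lift'_gt0.
Qed.

Lemma blaschke_lift_inj : injective th.
Proof.
by move=> x y h; case: (ltrgtP x y) => //;
  rewrite -blaschke_lift_mono h ltxx.
Qed.

(** The product has degree four, so it winds four times. *)
Lemma blaschke_lift2pi t : th (t + pi *+ 2) = th t + pi *+ 8.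
Proof.
rewrite /blaschke_lift !blaschke_angle2pi.
by rewrite (mulrnDr pi 2 6) (mulrnDr pi 2 4) (mulrnDr pi 2 2); ring.
Qed.

(** If the points agreed, the lift would have grown by $4(x-y)$ with $x-y$ a positive multiple of
    $2\pi$, hence by at least $8\pi$. *)
Lemma blaschke_lift_circle x y : 0 < th x - th y < pi *+ 8 -> E x <> E y.
Proof.
move=> /andP[h0 h8] Exy.
have ang a : blaschke_angle a x - x = blaschke_angle a y - y.
  have [cE sE] := Exy.
  by rewrite /blaschke_angle /den_re /den_im cE sE; ring.
have h4 : th x - th y = 4 * (x - y).
  have := ang c; have := ang p; have := ang q; rewrite /blaschke_lift; lra.
have [j xE] := circle_point_inj Exy; have pi0 := @pi_gt0 R.
have pi2 : 0 < pi *+ 2 :> R by rewrite pmulrn_lgt0.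
have : 0 < (pi *+ 2) *~ j :> R by move: xE; lra.
by move=> /(ler_mulrz_gt0 pi2); move: xE; lra.
Qed.

Lemma blaschke_lift_onto y : exists x, th x = y.
Proof.
(* Each of the three angles stays within $\pi$ of [t]. *)
apply: (increasing_onto (c := 4) (M := 3 * pi)) is_derive_blaschke_lift _ _ => //.
move=> t; rewrite /blaschke_lift.
have := blaschke_angle_bound c t; have := blaschke_angle_bound p t.
have := blaschke_angle_bound q t; rewrite !ler_norml.
by move=> /andP[? ?] /andP[? ?] /andP[? ?]; apply/andP; split; lra.
Qed.

Lemma exists_lift_inv : exists g : R -> R, cancel th g /\ cancel g th.
Proof.
have /choice[g hg] : forall y, exists x, th x = y by exact: blaschke_lift_onto.
by exists g; split=> // x; apply: blaschke_lift_inj; rewrite hg.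
Qed.

Definition lift_inv : R -> R := projT1 (cid exists_lift_inv).

Lemma lift_invK : cancel lift_inv th.
Proof. by have [] := projT2 (cid exists_lift_inv). Qed.

Lemma blaschke_liftK : cancel th lift_inv.
Proof. by have [] := projT2 (cid exists_lift_inv). Qed.

(** The value of [blaschke4] recurs exactly when the lift changes by a multiple of $2\pi$; one
    period is the first recurrence. *)
Definition next_angle t : R := lift_inv (th t + pi *+ 2).

Lemma lift_next t : th (next_angle t) = th t + pi *+ 2.
Proof. exact: lift_invK. Qed.

Lemma next_gt t : t < next_angle t.
Proof. by rewrite -blaschke_lift_mono lift_next ltrDl pmulrn_lgt0 ?pi_gt0. Qed.

Definition next_angle' t : R := blaschke_lift' t / blaschke_lift' (next_angle t).

Lemma next_angle'_gt0 t : 0 < next_angle' t.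
Proof. by rewrite divr_gt0 // blaschke_lift'_gt0. Qed.

Lemma is_derive_next t : is_derive t 1 next_angle (next_angle' t).
Proof.
have dI : is_derive (th t + pi *+ 2) 1 lift_inv (blaschke_lift' (next_angle t))^-1.
  rewrite -lift_next; apply: is_derive_inverse.
  - by near=> x; exact: blaschke_liftK.
  - have ct := is_derive_continuous is_derive_blaschke_lift.
    by near=> x; exact: ct.
  - exact: is_derive_blaschke_lift.
  - by rewrite gt_eqF // blaschke_lift'_gt0.
have dth : is_derive t 1 (fun x => th x + pi *+ 2) (blaschke_lift' t).
  have := is_deriveD (is_derive_blaschke_lift t) (is_derive_cst (pi *+ 2 : R) t 1).
  by rewrite addr0.
have h := @is_derive1_comp R lift_inv (fun x => th x + pi *+ 2) t _ _ dI dth.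
exact: is_derive_eq h (mulrC _ _).
Unshelve. all: by end_near.
Qed.

Lemma lift_eq x y : blaschke4 p q (E x) = blaschke4 p q (E y) ->
  exists k : int, th x = th y + (pi *+ 2) *~ k.
Proof.
by rewrite !blaschke4_lift => /oppr_inj; exact: circle_point_inj.
Qed.

Lemma blaschke4_next t : blaschke4 p q (E (next_angle t)) = blaschke4 p q (E t).
Proof. by rewrite !blaschke4_lift lift_next circle_point2pi. Qed.

(** The infimum is attained: at any later solution the increasing lift has gained a positive
    multiple of $2\pi$. *)
Lemma next_solutionE t : next_solution (blaschke4 p q) t = next_angle t.
Proof.
have pi2 : 0 < pi *+ 2 :> R by rewrite pmulrn_lgt0 ?pi_gt0.
have lbn : lbound [set s | t < s /\ blaschke4 p q (E s) = blaschke4 p q (E t)] (next_angle t).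
  move=> s /= [ts /lift_eq [k hk]].
  rewrite leNgt -blaschke_lift_mono lift_next hk ltrD2l -leNgt.
  move: ts; rewrite -blaschke_lift_mono hk ltrDl => h.
  exact: ler_mulrz_gt0.
have inS : [set s | t < s /\ blaschke4 p q (E s) = blaschke4 p q (E t)] (next_angle t).
  by split; [exact: next_gt|exact: blaschke4_next].
apply/eqP; rewrite eq_le; apply/andP; split.
  by apply: ge_inf => //; exists (next_angle t).
by apply: lb_le_inf => //; exists (next_angle t).
Qed.

(* If the next solution were the same point or the opposite vertex, then
   [z B_c z] would have wound at least once in between, leaving nothing for
   [B_p B_q], whose argument also increases. *)
Lemma tangent_form_next t : tangent_form (E t) (E (next_angle t)) = 0.
Proof.
have nt := next_gt t.
have ac := blaschke_angle_homo hc nt; have ap := blaschke_angle_homo hp nt.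
have aq := blaschke_angle_homo hq nt.
have lt : th (next_angle t) = th t + pi *+ 2 := lift_next t.
have wind : E (next_angle t + blaschke_angle c (next_angle t)) <> E (t + blaschke_angle c t).
  move=> /circle_point_inj [k hk].
  have pi0 := @pi_gt0 R.
  have pi2 : 0 < pi *+ 2 :> R by rewrite pmulrn_lgt0.
  have : 0 < (pi *+ 2) *~ k :> R by move: hk; lra.
  move=> /(ler_mulrz_gt0 pi2).
  by move: lt; rewrite /blaschke_lift hk; lra.
have [h|h|//] := blaschke4_eq_circle (esym (blaschke4_next t)).
  case: wind; rewrite (circle_pointD t) (circle_pointD (next_angle t)); apply: oppr_inj.
  by rewrite -!mulrN -!blaschke_factor_angle // h.
(* Opposite vertices: multiplied by the difference of the two points, the expression in [h] is the
   numerator of the difference of the values of $zB_c(z)$. *)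
case: wind; rewrite (circle_pointD t) (circle_pointD (next_angle t)); apply: oppr_inj.
rewrite -!mulrN -!blaschke_factor_angle // /blaschke_factor.
have d1 := circle_den_neq0 t hc; have d2 := circle_den_neq0 (next_angle t) hc.
rewrite !mulrA; apply/eqP; rewrite eqr_div // -subr_eq0; apply/eqP.
transitivity ((E t - E (next_angle t)) * (E t + E (next_angle t) - c - c^* * (E t * E (next_angle t)))).
  by ring.
by rewrite h mulr0.
Qed.

End BlaschkeLift.

(** * The envelope of the sides *)

Section TangentLines.
Variable R : realType.
Variables p q : R[i].
Hypotheses (hp : `|p| < 1) (hq : `|q| < 1).
Implicit Types (x y t mu d : R).

Local Notation Re := complex.Re.
Local Notation Im := complex.Im.
Local Notation E := (@circle_point R).
Local Notation k := (poncelet_minor p q).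
Local Notation G := (focal_dual p q k).
Local Notation A := (focal_mx p q k).

Definition coord_along (z : R[i]) mu : R := Re z * cos mu + Im z * sin mu.

Lemma coord_along_lt1 (z : R[i]) mu : `|z| < 1 -> coord_along z mu < 1.
Proof.
move=> /nrm_lt1; rewrite nrm_sqr /coord_along => h.
have := cos2Dsin2 mu; set c := cos mu; set s := sin mu => cs.
have := sqr_ge0 (Re z - c); have := sqr_ge0 (Im z - s); lra.
Qed.

Lemma coord_alongDpi (z : R[i]) mu : coord_along z (mu + pi) = - coord_along z mu.
Proof. by rewrite /coord_along cosDpi sinDpi; ring. Qed.

(* Tangents to the unit circle do not meet the conic: with [c] the Blaschke
   center, [4 (1 - p1) (1 - q1) - 4 k = |1-p|^2 |1-q|^2 + (1-|pq|^2) |1-c|^2]. *)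
Lemma poncelet_minor_lt mu : k < (1 - coord_along p mu) * (1 - coord_along q mu).
Proof.
have n0 := nrm_mul_lt1 hp hq; have hp1 := coord_along_lt1 mu hp.
have hq1 := coord_along_lt1 mu hq.
rewrite /poncelet_minor ltr_pdivrMr; last by lra.
move: n0; rewrite /coord_along in hp1 hq1 *; rewrite !nrm_sqr.
set p1 := Re p * _ + _ in hp1 *; set q1 := Re q * _ + _ in hq1 *.
(* Rotation by $-\mu$, which moves the point of the circle in direction [mu] to $1$. *)
pose p2 := Im p * cos mu - Re p * sin mu; pose q2 := Im q * cos mu - Re q * sin mu.
have cs := cos2Dsin2 mu.
have -> : Re p ^+ 2 + Im p ^+ 2 = p1 ^+ 2 + p2 ^+ 2.
  by rewrite -[LHS]mulr1 -cs /p1 /p2; ring.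
have -> : Re q ^+ 2 + Im q ^+ 2 = q1 ^+ 2 + q2 ^+ 2.
  by rewrite -[LHS]mulr1 -cs /q1 /q2; ring.
have -> : Re p * Re q + Im p * Im q = p1 * q1 + p2 * q2.
  by rewrite -[LHS]mulr1 -cs /p1 /p2 /q1 /q2; ring.
move: p1 p2 q1 q2 hp1 hq1 => p1 p2 q1 q2 hp1 hq1.
set P := p1 ^+ 2 + p2 ^+ 2; set Q := q1 ^+ 2 + q2 ^+ 2.
set n := 1 - P * Q => n0.
have e : 2 * ((1 - p1) * (1 - q1) * (2 * n)
     - (1 - P) * (1 - Q) * (1 - (p1 * q1 + p2 * q2))) =
   n * (((1 - p1) ^+ 2 + p2 ^+ 2) * ((1 - q1) ^+ 2 + q2 ^+ 2)) +
   ((n - (p1 * (1 - Q) + q1 * (1 - P))) ^+ 2 +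
    (p2 * (1 - Q) + q2 * (1 - P)) ^+ 2).
  by rewrite /n /P /Q; ring.
have : 0 < n * (((1 - p1) ^+ 2 + p2 ^+ 2) * ((1 - q1) ^+ 2 + q2 ^+ 2)).
  by rewrite !mulr_gt0 // ltr_wpDr ?sqr_ge0 // exprn_gt0 // subr_gt0.
have := sqr_ge0 (n - (p1 * (1 - Q) + q1 * (1 - P))).
have := sqr_ge0 (p2 * (1 - Q) + q2 * (1 - P)).
by lra.
Qed.

(** Tangents of the conic cut the circle in two points. For $d\ge1$ the product of the focal
    distances is at least its value at $d=1$, which exceeds $k$; the other side follows by a half
    turn. *)
Lemma tangent_distance_lt1 mu d :
  (coord_along p mu - d) * (coord_along q mu - d) = k -> `|d| < 1.
Proof.
have aux nu e : (coord_along p nu - e) * (coord_along q nu - e) = k -> e < 1.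
  move=> h; rewrite ltNge; apply/negP => e1.
  have := coord_along_lt1 nu hp; have := coord_along_lt1 nu hq => h1 h2.
  have := poncelet_minor_lt nu; rewrite -h ltNge => /negP; apply.
  rewrite -[leRHS]mulrNN !opprB; apply: ler_pM; lra.
move=> h; rewrite ltr_norml; apply/andP; split; last exact: aux h.
rewrite -ltrN2 opprK; apply: (aux (mu + pi)).
by rewrite !coord_alongDpi -h; ring.
Qed.

Definition mid_angle x y : R := (x + y) / 2.
Definition half_angle x y : R := (y - x) / 2.

(** The chord in normal form, with unit normal in the direction of the mean angle; at [x = y] it is
    the tangent. *)
Definition side_line x y : 'rV[R]_3 :=
  row3 (cos (mid_angle x y)) (sin (mid_angle x y)) (- cos (half_angle x y)).

Lemma quad_side_line x y : quad G (side_line x y) =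
  (coord_along p (mid_angle x y) - cos (half_angle x y)) *
  (coord_along q (mid_angle x y) - cos (half_angle x y)) - k.
Proof.
rewrite /quad confocal_dualE ?pnatr_eq0 // mxE mulr1n /coord_along.
have := cos2Dsin2 (mid_angle x y); rewrite -!expr2 => ->.
by field.
Qed.

Lemma circle_point_midl x y : E x = E (mid_angle x y) * (E (half_angle x y))^*.
Proof.
by rewrite -circle_pointN -circle_pointD /mid_angle /half_angle; congr E; field.
Qed.

Lemma circle_point_midr x y : E y = E (mid_angle x y) * E (half_angle x y).
Proof. by rewrite -circle_pointD /mid_angle /half_angle; congr E; field. Qed.

(** Dividing by the mid-angle point turns each focal factor into twice the signed distance of the
    focus from the chord. *)
Lemma tangent_formE x y : tangent_form p q (E x) (E y) =
  E (mid_angle x y) ^+ 2 * (4 * quad G (side_line x y))%:C.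
Proof.
rewrite quad_side_line (circle_point_midl x y) (circle_point_midr x y).
set m := E (mid_angle x y); set e := E (half_angle x y).
have ee : e * e^* = 1 := circle_point_conj _.
have mm : m * m^* = 1 := circle_point_conj _.
have e2 : e + e^* = (2 * cos (half_angle x y))%:C.
  rewrite /e /circle_point -[(_ +i* _)^*]/(_ -i* _); simpc.
  by congr (_ +i* _); ring.
have s z : z * m^* + m * z^* = (2 * coord_along z (mid_angle x y))%:C.
  rewrite /m /coord_along /circle_point; case: z => a b.
  rewrite -[(a +i* b)^*]/(a -i* b) -[(cos _ +i* _)^*]/(_ -i* _); simpc => /=.
  by congr (_ +i* _); ring.
have E1 : m * e^* + m * e = m * (2 * cos (half_angle x y))%:C by rewrite -e2; ring.
have E2 : m * e^* * (m * e) = m ^+ 2 by rewrite -[RHS]mulr1 -ee; ring.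
rewrite /tangent_form E1 E2.
have f z : z - m * (2 * cos (half_angle x y))%:C + m ^+ 2 * z^* =
    m * (2 * (coord_along z (mid_angle x y) - cos (half_angle x y)))%:C.
  have zE : z = z * (m * m^*) by rewrite mm mulr1.
  by rewrite [2 * (_ - _)]mulrBr rmorphB /= -s {1}zE; ring.
rewrite !f; set a := coord_along p _ - _; set b := coord_along q _ - _.
rewrite (_ : 4 * (a * b - k) = 2 * a * (2 * b) - 4 * k); last by ring.
by rewrite rmorphB rmorphM /=; ring.
Qed.

Lemma tangent_form0 x y :
  tangent_form p q (E x) (E y) = 0 <-> quad G (side_line x y) = 0.
Proof.
rewrite tangent_formE; split=> [/eqP|->]; last by rewrite mulr0 rmorph0 mulr0.
rewrite mulf_eq0 expf_eq0 (negPf (circle_point_neq0 _)) /= fmorph_eq0.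
by rewrite mulf_eq0 pnatr_eq0 => /eqP.
Qed.

Lemma tangent_formC (u v : R[i]) : tangent_form p q u v = tangent_form p q v u.
Proof. by rewrite /tangent_form [u + v]addrC [u * v]mulrC. Qed.

Lemma tangent_form_diag x : tangent_form p q (E x) (E x) <> 0.
Proof.
move/tangent_form0; rewrite quad_side_line /half_angle subrr mul0r cos0 => h.
have := poncelet_minor_lt (mid_angle x x).
by move: h; set a := coord_along p _; set b := coord_along q _; lra.
Qed.

(** The form is quadratic in its second argument. Three distinct roots would make it zero by
    Lagrange interpolation, also at [E x], where the line is a tangent of the circle and misses the
    conic. *)
Lemma tangent_form_roots x (v1 v2 v3 : R[i]) :
  tangent_form p q (E x) v1 = 0 -> tangent_form p q (E x) v2 = 0 ->
  tangent_form p q (E x) v3 = 0 -> [\/ v1 = v2, v1 = v3 | v2 = v3].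
Proof.
move=> h1 h2 h3.
have [->|n12] := eqVneq v1 v2; first by constructor 1.
have [->|n13] := eqVneq v1 v3; first by constructor 2.
have [->|n23] := eqVneq v2 v3; first by constructor 3.
case: (@tangent_form_diag x).
have lag v : (v1 - v2) * (v1 - v3) * (v2 - v3) * tangent_form p q (E x) v =
    (v - v2) * (v - v3) * (v2 - v3) * tangent_form p q (E x) v1
  - (v - v1) * (v - v3) * (v1 - v3) * tangent_form p q (E x) v2
  + (v - v1) * (v - v2) * (v1 - v2) * tangent_form p q (E x) v3.
  by rewrite /tangent_form; ring.
move: (lag (E x)); rewrite h1 h2 h3 !mulr0 subr0 addr0.
move: (tangent_form _ _ _ _) => f /eqP; rewrite !mulf_eq0 !subr_eq0.
by rewrite (negPf n12) (negPf n13) (negPf n23) => /eqP.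
Qed.

Lemma side_lineC x y : side_line x y = side_line y x.
Proof.
rewrite /side_line /mid_angle /half_angle [y + x]addrC -(opprB x y) mulNr cosN.
by [].
Qed.

(** Shifting [y] by $2\pi j$ shifts the mid and half angles by $\pi j$, which multiplies the line by
    $\pm1$. *)
Lemma side_line_eq x y y' : E y = E y' -> (side_line x y == side_line x y')%MS.
Proof.
move=> /circle_point_inj [j ->].
set T := (pi *+ 2) *~ j; pose w : R := pi *~ j.
have TE : T = w + w by rewrite /T /w mulr2n mulrzDl.
rewrite [side_line x (y' + T)]/side_line.
have -> : mid_angle x (y' + T) = mid_angle x y' + w by rewrite /mid_angle TE; field.
have -> : half_angle x (y' + T) = half_angle x y' + w by rewrite /half_angle TE; field.
have : E w * E w = 1.
  by rewrite -circle_pointD -TE -[T]add0r circle_point2piz /circle_point cos0 sin0.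
suff aux s : s != 0 -> cos w = s -> sin w = 0 ->
    (side_line x y' == row3 (cos (mid_angle x y' + w)) (sin (mid_angle x y' + w))
       (- cos (half_angle x y' + w)))%MS.
  rewrite eq_row_sym => /eqP.
  rewrite -expr2 sqrf_eq1 => /orP[] /eqP [cw sw].
    by apply: aux cw sw; rewrite oner_eq0.
  by apply: aux cw _; rewrite ?oppr_eq0 ?oner_eq0 // sw oppr0.
move=> s0 cw sw; rewrite !cosD !sinD cw sw !mulr0 !subr0 ?add0r ?addr0.
rewrite -mulNr ![_ * s]mulrC -scale_row3.
exact: eq_row_scale.
Qed.

Lemma circle_line x y z : incident (affine_point (E z)) (side_line x y) ->
  E z = E x \/ E z = E y.
Proof.
move=> /dot_row3_eq0 /= h.
have : (E z - E x) * (E z - E y) = 0.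
  rewrite (circle_point_midl x y) (circle_point_midr x y).
  set m := E (mid_angle x y); set e := E (half_angle x y).
  have ee : e * e^* = 1 := circle_point_conj _.
  have mm : m * m^* = 1 := circle_point_conj _.
  have zz : E z * (E z)^* = 1 := circle_point_conj _.
  have e2 : e + e^* = (2 * cos (half_angle x y))%:C.
    rewrite /e /circle_point -[(_ +i* _)^*]/(_ -i* _); simpc.
    by congr (_ +i* _); ring.
  have zm : E z * m^* + m * (E z)^* = (2 * cos (half_angle x y))%:C.
    have -> : cos (half_angle x y) = cos z * cos (mid_angle x y) + sin z * sin (mid_angle x y).
      by lra.
    rewrite /m /circle_point -!/(_ -i* _).
    rewrite -[(cos z +i* _)^*]/(_ -i* _) -[(cos (mid_angle x y) +i* _)^*]/(_ -i* _).
    by simpc => /=; congr (_ +i* _); ring.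
  transitivity (E z ^+ 2 - E z * m * (e + e^*) + m ^+ 2 * (e * e^*)); first by ring.
  rewrite e2 -zm ee.
  transitivity (E z ^+ 2 * (1 - m * m^*) + m ^+ 2 * (1 - E z * (E z)^*)).
    by ring.
  by rewrite mm zz !subrr !mulr0 addr0.
by move=> /eqP; rewrite mulf_eq0 !subr_eq0 => /orP[] /eqP; [left|right].
Qed.

Lemma incident_side_line x y : incident (affine_point (E x)) (side_line x y).
Proof.
apply/dot_row3_eq0 => /=; rewrite mul1r.
have -> : half_angle x y = mid_angle x y - x by rewrite /half_angle /mid_angle; field.
by rewrite cosB; ring.
Qed.

Lemma confocal_det_gt0 : 0 < confocal_det (Re p) (Im p) (Re q) (Im q) k.
Proof.
have k0 := poncelet_minor_gt0 hp hq.
rewrite /confocal_det mulr_gt0 // ltr_wpDr // divr_ge0 //.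
by rewrite addr_ge0 ?sqr_ge0.
Qed.

(** The signed distance of [z] from the chord; tangency says that the two foci have gaps of product
    $k$. *)
Definition side_gap (z : R[i]) x y : R := coord_along z (mid_angle x y) - cos (half_angle x y).

Lemma side_gapE z x y :
  incident (affine_point z) (side_line x y) <-> side_gap z x y = 0.
Proof.
rewrite /side_gap /coord_along; split=> [/dot_row3_eq0|h] /=.
  by rewrite mul1r.
by apply/dot_row3_eq0; rewrite /= mul1r.
Qed.

End TangentLines.

(** * Differentiation along the family of sides *)

Section Envelope.
Variable R : realType.
Variables p q : R[i].
Hypotheses (hp : `|p| < 1) (hq : `|q| < 1).
Implicit Types (z : R[i]) (x y t : R).

Local Notation Re := complex.Re.
Local Notation Im := complex.Im.
Local Notation E := (@circle_point R).
Local Notation k := (poncelet_minor p q).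
Local Notation G := (focal_dual p q k).
Local Notation A := (focal_mx p q k).
Local Notation det := (confocal_det (Re p) (Im p) (Re q) (Im q) k).
Local Notation next := (next_angle hp hq).
Local Notation next' := (next_angle' hp hq).
Local Notation line t := (side_line t (next t)).
Local Notation mu t := (mid_angle t (next t)).
Local Notation del t := (half_angle t (next t)).
Local Notation gap z t := (side_gap z t (next t)).

Definition gap' z t : R :=
  (Im z * cos (mu t) - Re z * sin (mu t)) * ((1 + next' t) / 2)
  + sin (del t) * ((next' t - 1) / 2).

(** The derivative of the moving side, whose mid and half angles have derivatives $(n'+1)/2$ and
    $(n'-1)/2$ for $n'$ = [next' t]. *)
Definition line' t : 'rV[R]_3 :=
  row3 (- sin (mu t) * ((1 + next' t) / 2)) (cos (mu t) * ((1 + next' t) / 2))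
       (sin (del t) * ((next' t - 1) / 2)).

Lemma is_derive_half (f g : R -> R) t a b : is_derive t 1 f a ->
  is_derive t 1 g b -> is_derive t 1 (fun x => (f x + g x) / 2) ((a + b) / 2).
Proof.
move=> hf hg; have h := is_deriveZ (2^-1 : R) (is_deriveD hf hg).
have -> : (fun x => (f x + g x) / 2) = 2^-1 \*: (f + g).
  by apply/funext => x; rewrite mulrC.
by apply: is_derive_eq h _; rewrite mulrC.
Qed.

Lemma is_derive_mid t :
  is_derive t 1 (fun t => mu t) ((1 + next' t) / 2).
Proof. exact: is_derive_half (is_derive_id t 1) (is_derive_next hp hq t). Qed.

Lemma is_derive_halfgap t :
  is_derive t 1 (fun t => del t) ((next' t - 1) / 2).
Proof.
exact: is_derive_half (is_derive_next hp hq t) (is_deriveN (is_derive_id t 1)).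
Qed.

Lemma is_derive_gap z t : is_derive t 1 (fun t => gap z t) (gap' z t).
Proof.
have dc := @is_derive1_comp R cos (fun t => mu t) t _ _ (is_derive_cos _) (is_derive_mid t).
have ds := @is_derive1_comp R sin (fun t => mu t) t _ _ (is_derive_sin _) (is_derive_mid t).
have dd :=
  @is_derive1_comp R cos (fun t => del t) t _ _ (is_derive_cos _) (is_derive_halfgap t).
have h := is_deriveB (is_deriveD (is_deriveZ (Re z) dc) (is_deriveZ (Im z) ds)) dd.
apply: is_derive_eq h _.
by rewrite /GRing.scale /= /gap'; ring.
Qed.

Lemma is_derive_sin_half t : exists a, is_derive t 1 (fun t => sin (del t)) a.
Proof.
eexists; exact: (@is_derive1_comp R sin (fun t => del t) t _ _ (is_derive_sin _)
  (is_derive_halfgap t)).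
Qed.

Lemma side_formE z t : side_form (blaschke4 p q) z t = - 2 * sin (del t) * gap z t.
Proof.
rewrite /side_form next_solutionE.
set m := mu t; set d := del t.
have -> : E t = E (m - d) by congr E; rewrite /m /d /mid_angle /half_angle; field.
have -> : E (next t) = E (m + d) by congr E; rewrite /m /d /mid_angle /half_angle; field.
rewrite /side_gap -/m -/d /coord_along.
have sc : sin m ^+ 2 = 1 - cos m ^+ 2 by rewrite -(cos2Dsin2 m); ring.
rewrite /circle_point !cosD !sinD cosN sinN; case: z => z1 z2 /=.
by ring: sc.
Qed.

(** A full turn raises the lift by $8\pi$, more than the $2\pi$ of one step, so the next solution
    comes within a turn. *)
Lemma half_bounds t : 0 < del t < pi.
Proof.
have h1 := next_gt hp hq t.
have h2 : next t < t + pi *+ 2.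
  rewrite -(blaschke_lift_mono hp hq) lift_next blaschke_lift2pi // ltrD2l.
  by rewrite ltr_pMn2l ?pi_gt0.
by rewrite /half_angle; apply/andP; split; lra.
Qed.

Lemma sin_half_neq0 t : sin (del t) != 0.
Proof. by rewrite gt_eqF // sin_gt0_pi // half_bounds. Qed.

Lemma quad_line t : quad G (line t) = 0.
Proof. exact/tangent_form0/tangent_form_next. Qed.

(* The tangency relation differentiated along the family of sides. *)
Lemma line_polar t : line t *m G *m (line' t)^T = 0.
Proof.
have dp := is_derive_gap p t; have dq := is_derive_gap q t.
have dM := is_deriveM dp dq.
have cst : (fun t => gap p t) * (fun t => gap q t) = cst k.
  apply/funext => x; apply/eqP; rewrite -subr_eq0.
  by have := quad_line x; rewrite quad_side_line => ->.
rewrite cst in dM.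
have e : gap p t * gap' q t + gap q t * gap' p t = 0.
  have := derive_val (is_derive := dM); rewrite derive_cst => <-.
  by [].
rewrite confocal_dualE ?pnatr_eq0 //.
rewrite [X in X%:M](_ : _ = 0) ?raddf0 //.
apply: (@mulfI _ 2); first by rewrite pnatr_eq0.
rewrite mulr0 -[RHS]e /side_gap /coord_along /gap'.
by field.
Qed.

Lemma gap_line z t : gap z t = 0 <-> affine_point z *m (line t)^T = 0.
Proof. by rewrite -side_gapE. Qed.

Lemma gap'_line z t : gap' z t = 0 <-> affine_point z *m (line' t)^T = 0.
Proof.
rewrite /gap'; split=> [h|/dot_row3_eq0 /= <-]; last by ring.
by apply/dot_row3_eq0 => /=; rewrite -[RHS]h; ring.
Qed.

(** The form and the gap differ by the nonvanishing factor $-2\sin$ of the half angle, so by the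
    product rule they have the same double zeros. *)
Lemma envelope_gap z t :
  side_form (blaschke4 p q) z t = 0 /\
  is_derive t (1 : R) (side_form (blaschke4 p q) z) (0 : R) <->
  gap z t = 0 /\ gap' z t = 0.
Proof.
have [a da] := is_derive_sin_half t.
have dg := is_derive_gap z t.
have dM := is_deriveM (is_deriveZ (-2 : R) da) dg.
have sE : side_form (blaschke4 p q) z =
    (-2 \*: (fun t => sin (del t))) * (fun t => gap z t).
  by apply/funext => x; rewrite side_formE.
rewrite -sE in dM.
have n0 : - 2 * sin (del t) != 0 by rewrite mulf_neq0 ?sin_half_neq0 // oppr_eq0 pnatr_eq0.
rewrite side_formE; split=> [[/eqP + d0]|[g0 g0']].
  rewrite mulf_eq0 (negPf n0) /= => /eqP g0; split=> //.
  have := derive_val (is_derive := d0); rewrite (derive_val (is_derive := dM)).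
  rewrite /= g0 scale0r addr0 => /eqP; rewrite mulf_eq0 => /orP[|/eqP //].
  by rewrite (negPf n0).
rewrite g0 mulr0; split=> //; apply: is_derive_eq dM _.
by rewrite g0 g0' scale0r scaler0 addr0.
Qed.

End Envelope.

(** * Equality of conic and envelope, and the inscribed quadrilateral *)

Section Main.
Variable R : realType.
Implicit Types (z : R[i]) (x y t : R).

Local Notation Re := complex.Re.
Local Notation Im := complex.Im.
Local Notation E := (@circle_point R).

Lemma polar_coordinates (a b : R) : (a != 0) || (b != 0) ->
  exists r mu : R, [/\ 0 < r, a = r * cos mu & b = r * sin mu].
Proof.
move=> ab0; set r := Num.sqrt (a ^+ 2 + b ^+ 2).
have ab : 0 < a ^+ 2 + b ^+ 2.
  rewrite lt_neqAle addr_ge0 ?sqr_ge0 // andbT eq_sym paddr_eq0 ?sqr_ge0 //.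
  by rewrite !sqrf_eq0 negb_and.
have r0 : 0 < r by rewrite sqrtr_gt0.
have rn0 : r != 0 by rewrite gt_eqF.
have r2 : r ^+ 2 = a ^+ 2 + b ^+ 2 by rewrite sqr_sqrtr // ltW.
have e : 1 - (a / r) ^+ 2 = (b / r) ^+ 2.
  rewrite !expr_div_n; apply: (@mulIf _ (r ^+ 2)); first by rewrite expf_neq0.
  by rewrite mulrBl !divfK ?expf_neq0 // mul1r r2; ring.
have ar : -1 <= a / r <= 1.
  have : `|a / r| ^+ 2 <= 1.
    by rewrite real_normK ?num_real //; have := sqr_ge0 (b / r); lra.
  by rewrite expr_le1 // ler_norml.
have ca : cos (acos (a / r)) = a / r by rewrite acosK // in_itv.
have sa : sin (acos (a / r)) = `|b / r| by rewrite sin_acos // e sqrtr_sqr.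
have [b0|b0] := lerP 0 (b / r).
  exists r, (acos (a / r)); split=> //; rewrite ?ca ?sa ?ger0_norm //;
    by rewrite mulrC divfK.
exists r, (- acos (a / r)); split=> //.
  by rewrite cosN ca mulrC divfK.
by rewrite sinN sa ltr0_norm // opprK mulrC divfK.
Qed.

Variables p q : R[i].
Hypotheses (hp : `|p| < 1) (hq : `|q| < 1).

Local Notation k := (poncelet_minor p q).
Local Notation G := (focal_dual p q k).
Local Notation A := (focal_mx p q k).
Local Notation det := (confocal_det (Re p) (Im p) (Re q) (Im q) k).
Local Notation next := (next_angle hp hq).
Local Notation line t := (side_line t (next t)).
Local Notation line' t := (line' hp hq t).
Local Notation gap z t := (side_gap z t (next t)).
Local Notation gap' z t := (gap' hp hq z t).

Let GA : G *m A = det%:M.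
Proof. by apply: mul_confocal_dual_mx; rewrite pnatr_eq0. Qed.

Let AG : A *m G = det%:M.
Proof. by apply: mul_confocal_mx_dual; rewrite pnatr_eq0. Qed.

Let det_neq0 : det != 0. Proof. by rewrite gt_eqF // confocal_det_gt0. Qed.

Lemma affine_point_neq0 z : affine_point z != 0.
Proof. by rewrite row3_eq0 oner_eq0 !andbF. Qed.

Lemma dotC (u v : 'rV[R]_3) : u *m v^T = 0 -> v *m u^T = 0.
Proof. by move=> h; rewrite -[v]trmxK -trmx_mul h trmx0. Qed.

Lemma side_line_neq0 x y : side_line x y != 0 :> 'rV[R]_3.
Proof.
rewrite row3_eq0; apply/negP => /and3P[/eqP c0 /eqP s0 _].
have := cos2Dsin2 (mid_angle x y); rewrite c0 s0 !expr0n addr0 => /esym/eqP.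
by rewrite oner_eq0.
Qed.

Lemma quad0E (M : 'M[R]_3) v : quad M v = 0 -> v *m M *m v^T = 0.
Proof. by move/on_conicE. Qed.

(** Both [z] and the pole of the side are orthogonal to the side and its derivative. These are
    independent, so [z] is the point of contact. *)
Lemma envelope_on_conic z t : gap z t = 0 -> gap' z t = 0 ->
  on_conic A (affine_point z).
Proof.
move=> /gap_line zl /gap'_line zl'.
have [g1 [g2 [g3 gE]]] := row3_eta (line t *m G).
have gl := quad0E (quad_line hp hq t); have gl' := line_polar hp hq t.
have [w perp] : exists w, forall u1 u2 u3 : R,
    row3 u1 u2 u3 *m (line t)^T = 0 -> row3 u1 u2 u3 *m (line' t)^T = 0 ->
    exists a, row3 u1 u2 u3 = a *: w.
  eexists => u1 u2 u3.
  move=> /dotC /dot_row3_eq0 h1 /dotC /dot_row3_eq0 h2.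
  apply: (perp_cross h1 h2 (k := 1) _ _ (esym (mul1r _))
    (esym (mul1r _)) (esym (mul1r _))); rewrite ?oner_eq0 //.
  (* The third coordinate of the cross product is the derivative of the mid angle, which is
     positive. *)
  rewrite row3_eq0 !negb_and; apply/orP; right; apply/orP; right.
  have := cos2Dsin2 (mid_angle t (next t)).
  set c := cos _; set s := sin _ => cs.
  have -> : forall m, c * (c * m) - s * (- s * m) = (c ^+ 2 + s ^+ 2) * m.
    by move=> m; ring.
  rewrite cs mul1r gt_eqF // divr_gt0 // addr_gt0 //.
  exact: next_angle'_gt0.
have [a aE] := perp _ _ _ zl zl'.
rewrite gE in gl gl'; have [b bE] := perp _ _ _ gl gl'.
have a0 : a != 0.
  apply: contraNneq (affine_point_neq0 z) => a0.
  by rewrite -[affine_point z]/(row3 _ _ _) aE a0 scale0r.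
have b0 : b != 0.
  apply: contraNneq (side_line_neq0 t (next t)) => b0.
  have : line t *m G *m A = 0 by rewrite gE bE b0 scale0r mul0mx.
  rewrite -mulmxA GA mul_mx_scalar => /eqP.
  by rewrite scaler_eq0 (negPf det_neq0).
have lG : line t *m G = (b / a) *: affine_point z.
  by rewrite gE bE -[affine_point z]/(row3 _ _ _) aE scalerA divfK.
have : (b / a) *: (affine_point z *m A *m (affine_point z)^T) = 0.
  rewrite !scalemxAl -lG -[_ *m G *m A]mulmxA GA mul_mx_scalar -scalemxAl.
  by rewrite dotC ?scaler0.
move=> /eqP; rewrite scaler_eq0 mulf_eq0 invr_eq0 (negPf a0) (negPf b0) /=.
by move/eqP.
Qed.

Lemma envelope_at z t c : affine_point z *m A = c *: line t ->
  on_conic A (affine_point z) -> gap z t = 0 /\ gap' z t = 0.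
Proof.
move=> zA hz; have c0 : c != 0.
  apply: contraNneq (affine_point_neq0 z) => c0.
  have : affine_point z *m A *m G = 0 by rewrite zA c0 scale0r mul0mx.
  rewrite -mulmxA AG mul_mx_scalar => /eqP.
  by rewrite scaler_eq0 (negPf det_neq0).
split.
  apply/gap_line/dotC; move: hz; rewrite /on_conic zA -scalemxAl => /eqP.
  by rewrite scaler_eq0 (negPf c0) => /eqP.
apply/gap'_line.
have : det *: affine_point z = c *: (line t *m G).
  by rewrite scalemxAl -zA -mulmxA AG mul_mx_scalar.
move=> /(congr1 (mulmx^~ (line' t)^T)); rewrite -!scalemxAl line_polar scaler0.
by move=> /eqP; rewrite scaler_eq0 (negPf det_neq0) => /eqP.
Qed.

(** The preceding solution is two steps behind the next one: the lifts differ by $4\pi<8\pi$, so the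
    points are distinct. *)
Lemma circle_point_prev x : exists2 s, next s = x & E (next x) <> E s.
Proof.
exists (lift_inv hp hq (blaschke_lift p q x - pi *+ 2)).
  by rewrite /next_angle lift_invK subrK blaschke_liftK.
apply: (@blaschke_lift_circle _ p q); rewrite lift_next lift_invK.
by have := @pi_gt0 R => pi0; apply/andP; split; lra.
Qed.

(** The polar of [z] is a tangent, hence a chord of the circle. From one of its ends only two
    tangent chords start, the sides to the next and to the preceding solution, so the polar is one
    of these. *)
Lemma conic_envelope z : on_conic A (affine_point z) ->
  exists t, gap z t = 0 /\ gap' z t = 0.
Proof.
move=> hz.
have [a [b [e lE]]] := row3_eta (affine_point z *m A).
have lneq0 : row3 a b e != 0.
  rewrite -lE; apply: contraNneq (affine_point_neq0 z) => h.
  have : affine_point z *m A *m G = 0 by rewrite h mul0mx.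
  rewrite -mulmxA AG mul_mx_scalar => /eqP.
  by rewrite scaler_eq0 (negPf det_neq0).
have lG0 : row3 a b e *m G *m (row3 a b e)^T = 0.
  rewrite -lE -[_ *m A *m G]mulmxA AG mul_mx_scalar trmx_mul tr_confocal_mx.
  by rewrite -scalemxAl mulmxA hz scaler0.
(* The line at infinity is not tangent: the dual form takes the value $e^2$ on $(0,0,e)$. *)
have ab0 : (a != 0) || (b != 0).
  apply/negPn/negP; rewrite negb_or !negbK => /andP[/eqP a0 /eqP b0].
  move: lG0 lneq0; rewrite a0 b0 confocal_dualE ?pnatr_eq0 //.
  move=> /matrixP/(_ 0 0); rewrite !mxE mulr1n => h.
  rewrite row3_eq0 !eqxx /= => /negP; apply.
  by rewrite -sqrf_eq0; apply/eqP; rewrite -[RHS]h; field.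
have [r [mu [r0 aE bE]]] := polar_coordinates ab0.
have rn0 : r != 0 by rewrite gt_eqF.
have [d eE] : exists d, e = - (r * d) by exists (- (e / r)); field.
have hd : (coord_along p mu - d) * (coord_along q mu - d) = k.
  move: lG0; rewrite confocal_dualE ?pnatr_eq0 //.
  move=> /matrixP/(_ 0 0); rewrite !mxE mulr1n => h.
  apply: (mulfI (expf_neq0 2 rn0)); apply/eqP; rewrite -subr_eq0; apply/eqP.
  have sc : sin mu ^+ 2 = 1 - cos mu ^+ 2 by rewrite -(cos2Dsin2 mu); ring.
  by rewrite -[RHS]h aE bE eE /coord_along; field: sc.
have := tangent_distance_lt1 hp hq hd; rewrite ltr_norml => /andP[d1 d2].
have dc : cos (acos d) = d by rewrite acosK // in_itv /= !ltW.
pose x := mu - acos d; pose y := mu + acos d.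
have ml : mid_angle x y = mu by rewrite /mid_angle /x /y; field.
have hl : half_angle x y = acos d by rewrite /half_angle /x /y; field.
have sl : row3 a b e = r *: side_line x y.
  by rewrite /side_line ml hl dc scale_row3 aE bE eE mulrN.
have Txy : tangent_form p q (E x) (E y) = 0.
  apply/tangent_form0; rewrite quad_side_line.
  by rewrite ml hl dc hd subrr.
have Txn := tangent_form_next hp hq x.
have [s sx nxs] := circle_point_prev x.
have Txs : tangent_form p q (E x) (E s) = 0.
  by rewrite (tangent_formC p q) -sx; exact: tangent_form_next.
suff [t /andP[/sub_rVP [c cE] _]] : exists t, (side_line x y == line t)%MS.
  exists t; apply: (envelope_at (c := r * c)) => //.
  by rewrite lE sl cE scalerA.
have [h|h|h] := tangent_form_roots hp hq Txy Txn Txs; last by case: nxs.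
  by exists x; exact: side_line_eq.
by exists s; rewrite sx [side_line s x]side_lineC; exact: side_line_eq.
Qed.

Lemma poncelet_conic_blaschke : poncelet_conic p q = blaschke_curve (blaschke4 p q).
Proof.
apply/seteqP; split=> z /=.
  by move=> /conic_envelope [t /(envelope_gap hp hq) ht]; exists t.
by move=> [t /(envelope_gap hp hq) [g g']]; exact: envelope_on_conic g g'.
Qed.

Let vtx (j : 'I_4) : R := iter j next 0.

Let lift_vtx j : blaschke_lift p q (vtx j) = blaschke_lift p q 0 + (pi *+ 2) *+ j.
Proof.
rewrite /vtx; elim: (nat_of_ord j) => [|n IH]; first by rewrite addr0.
by rewrite iterS lift_next IH -addrA -mulrSr.
Qed.

Let vtx_inj j j' : E (vtx j) = E (vtx j') -> j = j'.
Proof.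
have pi0 := @pi_gt0 R.
have aux (i i' : 'I_4) : (i < i')%N -> E (vtx i') <> E (vtx i).
  move=> ii'; apply: (@blaschke_lift_circle _ p q); rewrite !lift_vtx.
  rewrite opprD addrACA subrr add0r -mulrnBr 1?ltnW //.
  rewrite -mulrnA pmulrn_lgt0 ?muln_gt0 ?subn_gt0 // pi0 ltr_pMn2l //.
  by rewrite -[8%N]/(2 * 4)%N ltn_pmul2l // (leq_ltn_trans (leq_subr _ _)).
move=> h; apply/val_inj; case: (ltngtP j j') => // ij.
  by case: (aux _ _ ij).
by case: (aux _ _ ij).
Qed.

Let vtx_next j : E (next (vtx j)) = E (vtx (ordS j)).
Proof.
have [h|h] := ltnP j 3.
  congr E; rewrite /vtx (_ : ordS j = j.+1 :> nat) //.
  by rewrite /= modn_small.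
have j3 : j = 3%N :> nat by apply/eqP; rewrite eqn_leq h andbT -ltnS.
(* Four steps raise the lift by $8\pi$, which is exactly one turn, so the polygon closes. *)
have -> : next (vtx j) = 0 + pi *+ 2.
  apply: (blaschke_lift_inj hp hq).
  rewrite lift_next lift_vtx blaschke_lift2pi // j3 -addrA; congr (_ + _).
  by ring.
by rewrite circle_point2pi /vtx (_ : ordS j = 0%N :> nat) //= j3.
Qed.

Lemma poncelet_conic_inscribed : poncelet_inscribed 4 (poncelet_conic p q).
Proof.
exists A; split.
  split=> //; first exact: tr_confocal_mx.
  by apply: det_confocal_mx; rewrite ?pnatr_eq0.
pose v (j : 'I_4) := map_mx (real_complex R) (affine_point (E (vtx j))).
pose l (j : 'I_4) := map_mx (real_complex R) (line (vtx j)).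
have Eneq j : E (vtx j) <> E (vtx (ordS j)).
  move=> /vtx_inj /(congr1 (@nat_of_ord 4)).
  by case: j => [[|[|[|[|//]]]] hj].
have Eneq2 j : E (vtx j) <> E (vtx (ordS (ordS j))).
  move=> /vtx_inj /(congr1 (@nat_of_ord 4)).
  by case: j => [[|[|[|[|//]]]] hj].
have map_eq0 m n (M : 'M[R]_(m, n)) : M = 0 -> map_mx (real_complex R) M = 0.
  by move=> ->; rewrite map_mx0.
have v0 j : v j != 0 by rewrite map_mx_eq0 affine_point_neq0.
have l0 j : l j != 0 by rewrite map_mx_eq0 side_line_neq0.
have inc2' j : incident (affine_point (E (vtx (ordS j)))) (line (vtx j)).
  by rewrite -vtx_next side_lineC; exact: incident_side_line.
have inc1 j : incident (v j) (l j).
  rewrite /incident /v /l map_trmx -map_mxM; apply: map_eq0.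
  exact: incident_side_line.
have inc2 j : incident (v (ordS j)) (l j).
  by rewrite /incident /v /l map_trmx -map_mxM; apply: map_eq0; exact: inc2'.
have vv j j' : (v j == v j')%MS -> E (vtx j) = E (vtx j').
  rewrite /v !map_submx => /andP[/sub_rVP [c]].
  rewrite -![affine_point _]/(row3 _ _ _) scale_row3 mulr1 => /row3_inj [h1 h2 h3] _.
  by move: h1 h2; rewrite -h3 !mul1r /circle_point /= => -> ->.
have ll j j' : (l j == l j')%MS -> (line (vtx j) == line (vtx j'))%MS.
  by rewrite /l !map_submx.
have onT j : on_conic (map_mx (real_complex R) (circle_mx R)) (v j).
  rewrite /on_conic ?/v map_trmx -!map_mxM; apply: map_eq0.
  rewrite circle_mxE; apply/on_conicE; rewrite quad_sym3 /=.
  by have := cos2Dsin2 (vtx j); lra.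
have tanC j : tangent_line (map_mx (real_complex R) A) (l j).
  (* The point of contact is the pole of the side. *)
  pose P := line (vtx j) *m G.
  have PA : P *m A = det *: line (vtx j) by rewrite -mulmxA GA mul_mx_scalar.
  exists (map_mx (real_complex R) P); split.
  - rewrite map_mx_eq0; apply: contraNneq (side_line_neq0 (vtx j) (next (vtx j))) => P0.
    by move/eqP: PA; rewrite P0 mul0mx eq_sym scaler_eq0 (negPf det_neq0).
  - rewrite /on_conic ?/v map_trmx -!map_mxM; apply: map_eq0.
    rewrite PA trmx_mul tr_confocal_dual -scalemxAl mulmxA.
    by rewrite (quad0E (quad_line hp hq _)) scaler0.
  - by rewrite -map_mxM PA !map_submx; exact: eq_row_scale.
exists v, l; split; last first.
  move=> [P [L [_ _ h]]]; case: (Eneq ord0); apply: vv.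
  have [h0 _] := h ord0; have [h1 _] := h (ordS ord0).
  by rewrite eq_row_sym in h1; exact: eq_row_trans h0 h1.
move=> j; split=> //.
  by split=> // /vv /Eneq.
(* If consecutive sides agreed, their line would meet the circle in three distinct vertices. *)
split=> // /ll /andP[/sub_rVP [c cE] _]; case: (Eneq2 j).
have inc3 : incident (affine_point (E (vtx (ordS (ordS j))))) (line (vtx j)).
  by rewrite cE /incident linearZ /= -scalemxAr inc2' scaler0.
have [->//|h] := circle_line inc3.
by case: (Eneq (ordS j)); rewrite h vtx_next.
Qed.

End Main.

Theorem theorem5p13 (R : realType) (p q : R[i])
    (hp : `|p| < 1) (hq : `|q| < 1) :
  exists S : set R[i],
    [/\ unique (fun S' : set R[i] =>
                  conic_with_foci p q S' /\ poncelet_inscribed 4 S') S,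
        ellipse_with_foci p q S
      & S = blaschke_curve (blaschke4 p q)].
Proof.
exists (poncelet_conic p q); split; last exact: poncelet_conic_blaschke.
  split; first by split; [left; exact: poncelet_conic_ellipse|
                          exact: poncelet_conic_inscribed].
  move=> S [/conic_with_foci_focal [k [k0 ks ->]] hS].
  by rewrite (poncelet4_minor hp hq k0 ks hS).
exact: poncelet_conic_ellipse.
Qed.
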